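(* Let $p$ be a prime and let $\Pi$ be a profinite group. Then every finite $p$-embedding problem for $\Pi$ has a proper solution if and only if $\mathrm{cd}_p(\Pi)\leq 1$ and $\Pi$ is strongly $p$-dominating.
   Context: All actions and homomorphisms are assumed continuous; $\mathrm{cd}_p(\Pi)$ denotes the cohomological $p$-dimension of $\Pi$. An embedding problem for a profinite group $\Pi$ consists of profinite groups $\Gamma$, $G$ and epimorphisms $\alpha:\Pi\to G$ and $f:\Gamma\to G$. It is finite if $\Gamma$ is finite, and it is a $p$-embedding problem if its kernel $\ker(f)$ is a $p$-group. A proper solution is a surjective homomorphism $\beta:\Pi\to\Gamma$ with $f\circ\beta=\alpha$. A profinite group $\Pi$ is called strongly $p$-dominating if $H^1(\Pi,P)$ is infinite for every nontrivial finite elementary abelian $p$-group $P$ on which $\Pi$ acts (continuously, by group automorphisms). *)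

(* Defs.v *)
From HB Require Import structures.
From mathcomp Require Import all_boot all_order all_algebra all_fingroup all_solvable.
From mathcomp Require Import generic_quotient ring_quotient.
From mathcomp Require Import boolp classical_sets functions cardinality.
From mathcomp Require Import topology.

Set Implicit Arguments.
Unset Strict Implicit.
Unset Printing Implicit Defensive.

Import GRing.Theory.

Local Open Scope classical_set_scope.
Local Open Scope ring_scope.

HB.structure Definition PreTopologicalGroup :=
  {G of Topological G & monoid.Group G}.

HB.mixin Record PreTopologicalGroup_isTopologicalGroup G
    & PreTopologicalGroup G := {
  mulg_continuous : continuous (fun x : G * G => x.1 * x.2)%g;
  invg_continuous : continuous (fun x : G => x^-1)%g
}.

#[short(type="topologicalGroupType")]
HB.structure Definition TopologicalGroup :=
  {G of PreTopologicalGroup G & PreTopologicalGroup_isTopologicalGroup G}.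

HB.mixin Record TopologicalGroup_isProfinite G & TopologicalGroup G := {
  profinite_compact : compact [set: G];
  profinite_hausdorff : hausdorff_space G;
  profinite_totally_disconnected : totally_disconnected [set: G]
}.

#[short(type="profiniteGroupType")]
HB.structure Definition ProfiniteGroup :=
  {G of TopologicalGroup G & TopologicalGroup_isProfinite G}.

Record embedding_problem (Pi : profiniteGroupType) := EmbeddingProblem {
  ep_Gamma : profiniteGroupType;
  ep_G : profiniteGroupType;
  ep_alpha : {multiplicative Pi -> ep_G};
  ep_f : {multiplicative ep_Gamma -> ep_G};
  ep_alpha_continuous : continuous ep_alpha;
  ep_f_continuous : continuous ep_f;
  ep_alpha_surjective : range ep_alpha = [set: ep_G];
  ep_f_surjective : range ep_f = [set: ep_G]
}.

Definition finite_ep (Pi : profiniteGroupType) (E : embedding_problem Pi) :=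
  finite_set [set: ep_Gamma E].

(* A p-group is a group all of whose elements have p-power order; for finite
   groups this says that the order is a power of p. *)
Definition p_ep (p : nat) (Pi : profiniteGroupType)
    (E : embedding_problem Pi) :=
  forall x : ep_Gamma E, ep_f E x = 1%g -> exists k, (x ^+ (p ^ k) = 1)%g.

Definition has_proper_solution (Pi : profiniteGroupType)
    (E : embedding_problem Pi) :=
  exists beta : {multiplicative Pi -> ep_Gamma E},
    [/\ continuous beta, range beta = [set: ep_Gamma E] &
        forall x, ep_f E (beta x) = ep_alpha E x].

(* Joint continuity, for the discrete topology on A. *)
Record discrete_gmodule (G : topologicalGroupType) (A : zmodType) :=
  DiscreteGmodule {
  gact :> G -> A -> A;
  gact1 : forall a, gact 1%g a = a;
  gactM : forall g h a, gact (g * h)%g a = gact g (gact h a);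
  gactD : forall g a b, gact g (a + b) = gact g a + gact g b;
  gact_continuous : continuous
    (fun x : G * discrete_topology A => gact x.1 x.2 : discrete_topology A)
}.

Section Cohomology.
Variables (G : topologicalGroupType) (A : zmodType).
Variable M : discrete_gmodule G A.

Lemma gactB g a b : M g (a - b) = M g a - M g b.
Proof.
by apply/eqP; rewrite eq_sym subr_eq -gactD subrK.
Qed.

(* Inhomogeneous cochains, not required to be continuous; G^q is represented
   by families indexed by 'I_q, with the product topology. *)
Definition cochain q := {ptws 'I_q -> G} -> A.

HB.instance Definition _ q := GRing.Zmodule.on (cochain q).

Definition continuous_cochain q (f : cochain q) :=
  continuous (f : {ptws 'I_q -> G} -> discrete_topology A).

Lemma continuous_cochain0 q : continuous_cochain (0 : cochain q).
Proof. exact: cst_continuous. Qed.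

Lemma continuous_cochainB q (f h : cochain q) :
  continuous_cochain f -> continuous_cochain h -> continuous_cochain (f - h).
Proof.
move=> cf ch x A0 /= /nbhs_singleton Ax.
have fx : nbhs (x : {ptws 'I_q -> G}) [set y | f y = f x].
  exact: cf x _ (discrete_set1 (f x : discrete_topology A)).
have hx : nbhs (x : {ptws 'I_q -> G}) [set y | h y = h x].
  exact: ch x _ (discrete_set1 (h x : discrete_topology A)).
suff : nbhs (x : {ptws 'I_q -> G}) [set y | A0 ((f - h) y)] by [].
apply: filterS2 fx hx => y /= fy hy.
by rewrite -[(f - h) y]/(f y - h y) fy hy.
Qed.

(* (g_0, ..., g_q) |-> (g_0, ..., g_i g_(i+1), ..., g_q) *)
Definition merge_at q (i : 'I_q) (g : {ptws 'I_q.+1 -> G}) : {ptws 'I_q -> G} :=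
  fun j => if j == i then (g (widen_ord (leqnSn q) j) * g (lift ord0 j))%g
           else g (lift (lift ord0 i) j).

Definition cobound q (f : cochain q) : cochain q.+1 := fun g =>
  M (g ord0) (f (fun j => g (lift ord0 j)))
  + \sum_(i < q) f (merge_at i g) *~ (-1) ^+ i.+1
  + f (fun j => g (lift ord_max j)) *~ (-1) ^+ q.+1.

Lemma coboundB q (f h : cochain q) : cobound (f - h) = cobound f - cobound h.
Proof.
apply/funext => g; rewrite [RHS]/(cobound f g - cobound h g) /cobound.
have E y : (f - h) y = f y - h y by [].
rewrite !E gactB mulrzBl.
under eq_bigr do rewrite E mulrzBl.
by rewrite sumrB !opprD [RHS]addrACA; congr (_ + _); rewrite [RHS]addrACA.
Qed.

Definition is_cocycle q : {pred cochain q} :=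
  fun f => `[< continuous_cochain f /\ cobound f = 0 >].

Lemma cocycle_zmod_closed q : zmod_closed (@is_cocycle q).
Proof.
split=> [|f h /asboolP[cf df0] /asboolP[ch dh0]]; apply/asboolP.
  split; first exact: continuous_cochain0.
  by rewrite -[X in cobound X](subrr 0) coboundB subrr.
split; first exact: continuous_cochainB.
by rewrite coboundB df0 dh0 subrr.
Qed.

HB.instance Definition _ q :=
  GRing.isZmodClosed.Build (cochain q) (@is_cocycle q) (@cocycle_zmod_closed q).

Record cocycle q := Cocycle {
  cocycle_val :> cochain q;
  _ : cocycle_val \in @is_cocycle q
}.
HB.instance Definition _ q := [isSub for @cocycle_val q].
HB.instance Definition _ q := [Choice of cocycle q by <:].
HB.instance Definition _ q := [SubChoice_isSubZmodule of cocycle q by <:].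

(* Coboundaries are singled out inside the group of cocycles, so that the
   quotient below makes sense without first proving that cobound squares to
   zero. *)
Definition is_coboundary q : {pred cocycle q} :=
  match q with
  | 0 => fun z => z == 0
  | q'.+1 => fun z => `[< exists2 f : cochain q',
      continuous_cochain f & \val z = cobound f >]
  end.

Lemma coboundary_zmod_closed q : zmod_closed (@is_coboundary q).
Proof.
case: q => [|q]; split.
- exact: eqxx.
- by move=> z w /eqP -> /eqP ->; rewrite subr0; exact: eqxx.
- apply/asboolP; exists 0; first exact: continuous_cochain0.
  by rewrite -[X in cobound X](subrr 0) coboundB subrr.
- move=> z w /asboolP[f cf zf] /asboolP[h ch wh]; apply/asboolP.
  exists (f - h); first exact: continuous_cochainB.
  by rewrite coboundB -zf -wh.
Qed.

HB.instance Definition _ q :=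
  GRing.isZmodClosed.Build (cocycle q) (@is_coboundary q)
    (@coboundary_zmod_closed q).

Definition cohomology q : zmodType := Quotient.quot (@is_coboundary q).

End Cohomology.

(* cd_le p G n states cd_p(G) <= n, where cd_p(G) is the least n (or infinity)
   such that for all q > n and all discrete torsion G-modules A the p-primary
   component of H^q(G, A) vanishes. *)
Definition cd_le (p : nat) (G : topologicalGroupType) (n : nat) :=
  forall (A : zmodType) (M : discrete_gmodule G A),
    (forall a : A, exists2 m, (0 < m)%N & a *+ m = 0) ->
  forall q, (n < q)%N ->
  forall c : cohomology M q, (exists k, c *+ (p ^ k) = 0) -> c = 0.

Definition strongly_dominating (p : nat) (G : topologicalGroupType) :=
  forall (P : finZmodType) (M : discrete_gmodule G P),
    (p.-abelem [set: P]%G)%g -> (1 < #|P|)%N ->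
  infinite_set [set: cohomology M 1].

(* Main.v *)
From HB Require Import structures.
From mathcomp Require Import all_boot all_algebra all_fingroup all_solvable.
From mathcomp Require Import mxabelem.
From mathcomp Require Import generic_quotient ring_quotient.
From mathcomp Require Import boolp classical_sets functions cardinality.
From mathcomp Require Import topology.
Require Import Defs.

(** If embedding problems are solvable and H^1(Pi, P) is finite, then so is the
    set Z^1 of crossed homomorphisms; but a proper solution of the split problem
    P^n x| H -> H, with H a finite quotient of Pi acting on P, has n distinct
    components in Z^1, which is absurd for large n. As for the
    cohomological dimension, one reduces to cocycles killed by a power of p.
    In degree 2 such a cocycle takes its values in a finite submodule and comes
    from a finite quotient of Pi, and a solution of the corresponding group
    extension problem exhibits it as a coboundary. Higher degrees follow by
    shifting the dimension along A -> Ind(A) -> Ind(A) / A.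

    Conversely, by induction on the order of Gamma one may assume that the
    kernel N is a minimal normal subgroup, hence an elementary abelian p-group.
    As H^2(Pi, N) = 0 there is a solution, and Z^1(Pi, N) acts simply
    transitively on the solutions. The image of a solution that is not
    surjective is a complement of N, so such a solution factors through G, and
    there are only finitely many of these; but Z^1(Pi, N) is infinite. *)

Set Implicit Arguments.
Unset Strict Implicit.
Unset Printing Implicit Defensive.

Import GRing.Theory.

Local Open Scope classical_set_scope.
Local Open Scope ring_scope.

(** * Locally constant maps *)

(** Continuity into a discrete target, phrased without a topology on [T], so that it applies to maps
    into function types, quotients and finite groups alike. *)
Definition locally_constant (X : topologicalType) T (f : X -> T) :=
  forall x, \forall y \near x, f y = f x.

Section LocallyConstant.
Variables (X : topologicalType) (T : Type).
Implicit Type f : X -> T.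

Lemma locally_constant_comp (Y : topologicalType) (h : Y -> X) f :
  continuous h -> locally_constant f -> locally_constant (f \o h).
Proof. by move=> ch lf y; apply: ch (lf (h y)). Qed.

Lemma locally_constant_post U (h : T -> U) f :
  locally_constant f -> locally_constant (h \o f).
Proof. by move=> lf x; apply: filterS (lf x) => y /= ->. Qed.

Lemma locally_constant_cst (t : T) : locally_constant (fun _ : X => t).
Proof. by move=> x; apply: filterE. Qed.

Lemma locally_constant_pair U f (g : X -> U) :
  locally_constant f -> locally_constant g ->
  locally_constant (fun x => (f x, g x)).
Proof. by move=> lf lg x; apply: filterS2 (lf x) (lg x) => y /= -> ->. Qed.

Lemma locally_constant_ext f g : f =1 g ->
  locally_constant f -> locally_constant g.
Proof. by move=> fg; have -> : g = f by apply/funext. Qed.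

End LocallyConstant.

Lemma locally_constant_continuous (X Y : topologicalType) (f : X -> Y) :
  locally_constant f -> continuous f.
Proof.
move=> lf x A /nbhs_singleton Ax.
suff : nbhs x [set y | A (f y)] by [].
by apply: filterS (lf x) => y /= ->.
Qed.

Lemma continuous_locally_constant (X Y : topologicalType) (f : X -> Y) :
  (forall y : Y, nbhs y [set y]) -> continuous f -> locally_constant f.
Proof. by move=> dY cf x; exact: cf x _ (dY (f x)). Qed.

Lemma continuous_discreteP (X : topologicalType) (A : choiceType) (f : X -> A) :
  continuous (f : X -> discrete_topology A) <-> locally_constant f.
Proof.
split; last exact: (@locally_constant_continuous X (discrete_topology A)).
by apply: (@continuous_locally_constant X (discrete_topology A)) => y;
  exact: discrete_set1.
Qed.

(* The tube lemma. *)
Lemma locally_constant_curry (X Y : topologicalType) T (f : X * Y -> T) :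
  compact [set: X] -> locally_constant f ->
  locally_constant (fun y x => f (x, y)).
Proof.
move=> /compact_near_coveringP cX lf y.
suff : \forall y' \near y, [set: X] `<=` (fun x => f (x, y') = f (x, y)).
  by apply: filterS => y' /= H; apply/funext => x; exact: H.
apply: (cX Y (nbhs y) (fun y' x => f (x, y') = f (x, y))) => x _.
have := lf (x, y) => -[[U V] /= [Ux Vy] UV].
exists (U, V) => // -[x' y'] /= [Ux' Vy'].
rewrite (UV (x', y')) //= (UV (x', y)) //=; split => //.
exact: nbhs_singleton.
Qed.

Lemma locally_constant_finite_range (X : topologicalType) T (f : X -> T) :
  compact [set: X] -> locally_constant f -> finite_set (range f).
Proof.
move=> /compact_near_coveringP cX lf.
(* This filter is generated by the up-sets of the finite sets of values. The near-covering form of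
   compactness then yields one finite set containing every [f x]. *)
pose F : set_system (set {classic T}) :=
  [set U | exists2 D, finite_set D & forall D', D `<=` D' -> U D'].
have FF : Filter F.
  split; first by exists set0.
    move=> U V [D fD DU] [E fE EV]; exists (D `|` E); first by rewrite finite_setU.
    by move=> D' DE; split; [apply: DU|apply: EV] => x ?; apply: DE; [left|right].
  by move=> U V UV [D fD DU]; exists D => // D' /DU; exact: UV.
have [] := cX _ F (fun D x => D (f x)) FF.
  move=> x _; exists ([set y | f y = f x], [set D | D (f x)]).
    split; first exact: lf.
    exists [set f x : {classic T}]; first exact: finite_set1.
    by move=> D'; apply.
  by move=> [x' D] /= [-> ].
move=> D fD /(_ D (@subset_refl _ _)) H.
by apply: (sub_finite_set _ fD) => _ [x _ <-]; exact: H.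
Qed.

Lemma compact_prodT (X Y : topologicalType) :
  compact [set: X] -> compact [set: Y] -> compact [set: X * Y].
Proof. by move=> cX cY; rewrite -setXTT; exact: compact_setX. Qed.

Lemma compact_ptws (I : eqType) (X : topologicalType) :
  compact [set: X] -> compact [set: {ptws I -> X}].
Proof.
move=> cX; have := @tychonoff I (fun=> X) (fun=> setT) (fun=> cX).
by congr compact; apply/seteqP; split.
Qed.

Lemma ptws_continuous (X : topologicalType) (I : eqType) (Y : topologicalType)
    (f : X -> {ptws I -> Y}) :
  (forall i, continuous (fun x => f x i)) -> continuous f.
Proof.
move=> cf x; apply/cvg_sup => i A [_ [[B oB <-] Bfx sBA]].
apply: filterS (sBA) _; apply: (cf i x); exact: open_nbhs_nbhs.
Qed.

Lemma ptws_proj_continuous (I : eqType) (X : topologicalType) (i : I) :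
  continuous (fun g : {ptws I -> X} => g i).
Proof. exact: (@proj_continuous I (fun=> X)). Qed.

Section TopologicalGroup.
Variable G : topologicalGroupType.

Lemma continuous_mulg (X : topologicalType) (f g : X -> G) :
  continuous f -> continuous g -> continuous (fun x => f x * g x)%g.
Proof.
move=> cf cg x.
have := @continuous_comp _ _ _ (fun x => (f x, g x)) (fun x : G * G => x.1 * x.2)%g.
by apply; [apply: cvg_pair; [exact: cf|exact: cg] | exact: mulg_continuous].
Qed.

End TopologicalGroup.

Lemma fst_continuous (X Y : topologicalType) : continuous (@fst X Y).
Proof. by move=> x; exact: cvg_fst. Qed.

Lemma snd_continuous (X Y : topologicalType) : continuous (@snd X Y).
Proof. by move=> x; exact: cvg_snd. Qed.

Lemma id_continuous (X : topologicalType) : continuous (fun x : X => x).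
Proof. by move=> x; exact: cvg_id. Qed.

Lemma discrete_nbhs (X : discreteTopologicalType) (x : X) (P : set X) :
  P x -> nbhs x P.
Proof. by rewrite nbhs_principalE => ?; exact/principal_filterP. Qed.

Lemma continuous_pair (X Y Z : topologicalType) (f : X -> Y) (g : X -> Z) :
  continuous f -> continuous g -> continuous (fun x => (f x, g x)).
Proof.
by move=> cf cg x; apply: cvg_pair; [exact: cf|exact: cg].
Qed.

(** * Cochains *)

Section DiscreteAction.
Variables (G : topologicalGroupType) (A : zmodType).

(** As [A] is discrete, a neighbourhood of [x] times the point [a] is a neighbourhood of [(x, a)];
    so joint continuity of an action can be checked on orbit maps. *)
Lemma orbit_map_continuous (act : G -> A -> A) :
  (forall a, locally_constant (act^~ a)) ->
  continuous
    (fun u : G * discrete_topology A => act u.1 u.2 : discrete_topology A).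
Proof.
move=> lact; apply: (@locally_constant_continuous _ (discrete_topology A)).
move=> [x a]; exists ([set y | act y a = act x a], [set a : discrete_topology A]).
  by split; [exact: lact|exact: discrete_set1].
by move=> [y b] /= [yx ->].
Qed.

Lemma gact_locally_constant (M : discrete_gmodule G A)
    (X : topologicalType) (f : X -> G) (h : X -> A) :
  continuous f -> locally_constant h -> locally_constant (fun x => M (f x) (h x)).
Proof.
move=> cf lh.
have lM : locally_constant (fun u : G * discrete_topology A => M u.1 u.2).
  by apply/continuous_discreteP; exact: gact_continuous.
move=> x; have [[U V] /= [Ux Vx] UV] := lM (f x, h x).
have fU : nbhs x (f @^-1` U) by exact: cf x _ Ux.
apply: filterS2 fU (lh x) => y /= Uy ->.
apply: (UV (f y, h x) (conj Uy _)).
exact: (@nbhs_singleton (discrete_topology A) _ _ Vx).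
Qed.

Lemma gact0 (M : discrete_gmodule G A) x : M x 0 = 0.
Proof. by apply: (addIr (M x 0)); rewrite -gactD !add0r. Qed.

Lemma gactN (M : discrete_gmodule G A) x a : M x (- a) = - M x a.
Proof. by rewrite -sub0r gactB gact0 sub0r. Qed.

Lemma gactMn (M : discrete_gmodule G A) x a n : M x (a *+ n) = M x a *+ n.
Proof. by elim: n => [|n IHn]; rewrite ?gact0// !mulrS gactD IHn. Qed.

HB.instance Definition _ (M : discrete_gmodule G A) x :=
  GRing.isZmodMorphism.Build A A (gact M x) (gactB M x).

End DiscreteAction.

Section Cons.
Variable G : topologicalGroupType.

Definition ptail q (g : {ptws 'I_q.+1 -> G}) : {ptws 'I_q -> G} :=
  fun j => g (lift ord0 j).

Definition pinit q (g : {ptws 'I_q.+1 -> G}) : {ptws 'I_q -> G} :=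
  fun j => g (lift ord_max j).

(** Tuples are analysed through their first entry and their tail: each face of [pcons x g] has a
    simple form, which leads to the recursion [cobound_pcons]. *)
Definition pcons q (x : G) (g : {ptws 'I_q -> G}) : {ptws 'I_q.+1 -> G} :=
  fun i => oapp g x (unlift ord0 i).

Lemma pcons0 q x (g : {ptws 'I_q -> G}) : pcons x g ord0 = x.
Proof. by rewrite /pcons unlift_none. Qed.

Lemma pconsS q x (g : {ptws 'I_q -> G}) j : pcons x g (lift ord0 j) = g j.
Proof. by rewrite /pcons liftK. Qed.

Lemma pconsK q x (g : {ptws 'I_q -> G}) : ptail (pcons x g) = g.
Proof. by apply/funext => j; rewrite /ptail pconsS. Qed.

Lemma pcons_eta q (g : {ptws 'I_q.+1 -> G}) : pcons (g ord0) (ptail g) = g.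
Proof.
by apply/funext => i; case: (unliftP ord0 i) => [j|] ->; rewrite ?pconsS ?pcons0.
Qed.

Lemma pinit_pcons q x (g : {ptws 'I_q.+1 -> G}) :
  pinit (pcons x g) = pcons x (pinit g).
Proof.
apply/funext => i; rewrite /pinit; case: (unliftP ord0 i) => [j|] ->.
  rewrite pconsS -(pconsS x g (lift ord_max j)); congr (pcons x g _).
  by apply: val_inj; rewrite /= /bump !leq0n !add1n ltnS addnS.
rewrite pcons0 -[RHS](pcons0 x g); congr (pcons x g _); exact: val_inj.
Qed.

Lemma merge_at0_pcons q x (g : {ptws 'I_q.+1 -> G}) :
  merge_at ord0 (pcons x g) = pcons (x * g ord0)%g (ptail g).
Proof.
apply/funext => i; rewrite /merge_at; case: (unliftP ord0 i) => [j|] ->.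
  rewrite eq_sym (negbTE (neq_lift _ _)) pconsS.
  rewrite /ptail -(pconsS x g (lift ord0 j)); congr (pcons x g _).
  exact: val_inj.
rewrite eqxx pcons0 pconsS; congr (_ * _)%g.
rewrite -[RHS](pcons0 x g); congr (pcons x g _); exact: val_inj.
Qed.

Lemma merge_atS_pcons q x (g : {ptws 'I_q.+1 -> G}) (i : 'I_q) :
  merge_at (lift ord0 i) (pcons x g) = pcons x (merge_at i g).
Proof.
apply/funext => k; rewrite /merge_at; case: (unliftP ord0 k) => [j|] ->.
  rewrite pconsS (inj_eq lift_inj) pconsS; case: eqP => _.
    congr (_ * _)%g; rewrite -(pconsS x g); congr (pcons x g _).
    exact: val_inj.
  rewrite -(pconsS x g); congr (pcons x g _).
  by apply: val_inj; rewrite /= /bump !leq0n !add1n ltnS addnS.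
rewrite (negbTE (neq_lift _ _)) pcons0 -[RHS](pcons0 x g).
by congr (pcons x g _); exact: val_inj.
Qed.

Lemma pcons_continuous q (X : topologicalType) (f : X -> G)
    (h : X -> {ptws 'I_q -> G}) :
  continuous f -> continuous h -> continuous (fun x => pcons (f x) (h x)).
Proof.
move=> cf ch; apply: ptws_continuous => i; rewrite /pcons.
case: (unlift ord0 i) => [j|//] /=.
move=> x; apply: (@continuous_comp _ _ _ h (fun g => g j)); first exact: ch.
exact: ptws_proj_continuous.
Qed.

Lemma ptail_continuous q : continuous (@ptail q).
Proof. by apply: ptws_continuous => i; exact: ptws_proj_continuous. Qed.

(* All the terms of the coboundary but the first, the one involving the
   action. *)
Definition face_sum (A : zmodType) q (f : {ptws 'I_q -> G} -> A)
    (g : {ptws 'I_q.+1 -> G}) : A :=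
  \sum_(i < q) f (merge_at i g) *~ (-1) ^+ i.+1 + f (pinit g) *~ (-1) ^+ q.+1.

Lemma raddf_face_sum (A B : zmodType) (u : {additive A -> B}) q f g :
  u (@face_sum A q f g) = face_sum (u \o f) g.
Proof.
by rewrite /face_sum raddfD raddf_sum raddfMz; under eq_bigr do rewrite raddfMz.
Qed.

Lemma face_sumB (A : zmodType) q (f h : {ptws 'I_q -> G} -> A) g :
  face_sum (fun g => f g - h g) g = face_sum f g - face_sum h g.
Proof.
rewrite /face_sum mulrzBl; under eq_bigr do rewrite mulrzBl.
by rewrite sumrB opprD addrACA.
Qed.

(** The first face merges [x] into [g]. The others are the faces of [g] with [x] kept in front, and
    their index moves by one, which reverses all signs. *)
Lemma face_sum_pcons (A : zmodType) q (f : {ptws 'I_q.+1 -> G} -> A) x g :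
  face_sum f (pcons x g) =
  - f (pcons (x * g ord0)%g (ptail g)) - face_sum (fun g => f (pcons x g)) g.
Proof.
rewrite /face_sum big_ord_recl merge_at0_pcons pinit_pcons expr1 mulrN1z.
rewrite -addrA opprD; congr (_ + (_ + _)).
  rewrite -sumrN; apply: eq_bigr => i _.
  by rewrite merge_atS_pcons exprS mulN1r mulrNz.
by rewrite exprS mulN1r mulrNz.
Qed.

Variables (A : zmodType) (M : discrete_gmodule G A).

Lemma coboundE q (f : cochain G A q) g :
  cobound M f g = M (g ord0) (f (ptail g)) + face_sum f g.
Proof. by rewrite /cobound /face_sum addrA. Qed.

Lemma cobound_pcons q (f : cochain G A q.+1) x g :
  cobound M f (pcons x g) =
  M x (f g) - f (pcons (x * g ord0)%g (ptail g))
  - face_sum (fun g => f (pcons x g)) g.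
Proof. by rewrite coboundE pcons0 pconsK face_sum_pcons addrA. Qed.

End Cons.

(** * Dimension shifting *)

Section ShiftModule.
Variables (G : topologicalGroupType) (A : zmodType) (M : discrete_gmodule G A).
Hypothesis G_compact : compact [set: G].

(* The module Ind(A) / A, where Ind(A) is the module of locally constant maps
   G -> A: every class has a unique representative vanishing at 1, which
   accounts for the correction term in the action below. *)
Definition is_shift : {pred G -> A} :=
  fun phi => `[< locally_constant phi /\ phi 1%g = 0 >].

Lemma shift_zmod_closed : zmod_closed is_shift.
Proof.
split=> [|f h /asboolP[lf f1] /asboolP[lh h1]]; apply/asboolP; split=> //.
- exact: locally_constant_cst.
- move=> x; apply: filterS2 (lf x) (lh x) => y fy hy.
  by rewrite -[LHS]/(f y - h y) fy hy.
- by rewrite -[LHS]/(f 1%g - h 1%g) f1 h1 subrr.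
Qed.

HB.instance Definition _ :=
  GRing.isZmodClosed.Build (G -> A) is_shift shift_zmod_closed.

Record shift := Shift { shift_val :> G -> A; _ : shift_val \in is_shift }.
HB.instance Definition _ := [isSub for shift_val].
HB.instance Definition _ := [Choice of shift by <:].
HB.instance Definition _ := [SubChoice_isSubZmodule of shift by <:].

Lemma shiftP (phi : shift) : locally_constant phi /\ phi 1%g = 0.
Proof. by case: phi => phi phiP; exact: (elimT (asboolP _) phiP). Qed.

Lemma shift_inj (phi psi : shift) : phi =1 psi -> phi = psi.
Proof. by move=> E; apply: val_inj; apply/funext. Qed.

Definition shift_fun (f : G -> A) (lf : locally_constant f) (f1 : f 1%g = 0) :
  shift := Shift (introT (asboolP _) (conj lf f1)).

Definition shift_eval (x : G) (phi : shift) : A := phi x.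

Lemma shift_eval_is_additive x : zmod_morphism (shift_eval x).
Proof. by []. Qed.

HB.instance Definition _ x :=
  GRing.isZmodMorphism.Build shift A (shift_eval x) (shift_eval_is_additive x).

(** [A] sits in Ind(A) as the maps [x |-> M x a]. Right translation by [g] gives [phi] the value
    [phi g] at 1, and subtracting the image of [phi g] restores the value 0 there. *)
Definition shift_act_fun (g : G) (phi : shift) (x : G) : A :=
  phi (x * g)%g - M x (phi g).

Lemma shift_act_subproof g phi :
  locally_constant (shift_act_fun g phi) /\ shift_act_fun g phi 1%g = 0.
Proof.
split; last by rewrite /shift_act_fun mul1g gact1 subrr.
have [lphi _] := shiftP phi.
have l1 := locally_constant_comp
  (continuous_mulg (@id_continuous G) (@cst_continuous _ _ g)) lphi.
have l2 := gact_locally_constant M (@id_continuous G)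
  (@locally_constant_cst G _ (phi g)).
move=> x; apply: filterS2 (l1 x) (l2 x) => y /= E1 E2.
by rewrite /shift_act_fun E1 E2.
Qed.

Definition shift_act g phi : shift :=
  shift_fun (proj1 (shift_act_subproof g phi)) (proj2 (shift_act_subproof g phi)).

Lemma shift_act1 phi : shift_act 1%g phi = phi.
Proof.
apply: shift_inj => x; rewrite /= /shift_act_fun mulg1.
by rewrite (proj2 (shiftP phi)) gact0 subr0.
Qed.

Lemma shift_actM g h phi :
  shift_act (g * h)%g phi = shift_act g (shift_act h phi).
Proof.
apply: shift_inj => x; rewrite /= /shift_act_fun /= /shift_act_fun.
by rewrite gactB !gactM mulgA opprB addrA subrK.
Qed.

Lemma shift_actD g phi psi :
  shift_act g (phi + psi) = shift_act g phi + shift_act g psi.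
Proof.
apply: shift_inj => x; rewrite /= /shift_act_fun.
have E y : (phi + psi) y = phi y + psi y by [].
rewrite -[RHS]/(shift_act_fun g phi x + shift_act_fun g psi x) /shift_act_fun.
by rewrite !E gactD opprD addrACA.
Qed.

(** Compactness of [G] enters here: the value at [x] is locally constant in [x] and [g] jointly, and
    the tube lemma makes this uniform in [x]. *)
Lemma shift_act_continuous phi : locally_constant (shift_act^~ phi).
Proof.
have [lphi _] := shiftP phi.
have c1 : continuous (fun u : G * G => u.1 * u.2)%g := mulg_continuous.
have l : locally_constant (fun u : G * G => phi (u.1 * u.2)%g - M u.1 (phi u.2)).
  have l1 := locally_constant_comp c1 lphi.
  have l2 := gact_locally_constant M (@fst_continuous G G)
    (locally_constant_comp (@snd_continuous G G) lphi).
  by move=> u; apply: filterS2 (l1 u) (l2 u) => v /= -> ->.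
move=> g; apply: filterS (locally_constant_curry G_compact l g) => h E.
by apply: shift_inj => x; move/(congr1 (@^~ x)): E.
Qed.

Definition shift_module : discrete_gmodule G shift :=
  DiscreteGmodule shift_act1 shift_actM shift_actD
    (orbit_map_continuous shift_act_continuous).

Lemma face_sum_shift q (F : {ptws 'I_q -> G} -> shift) g x :
  face_sum F g x = face_sum (fun g => F g x) g.
Proof. exact: (raddf_face_sum (shift_eval x)). Qed.

End ShiftModule.

(** The exponent is imposed on the values of the cocycle, and the module is quantified inside,
    because dimension shifting replaces [A] by [shift G A]. *)
Definition torsion_cocycles_bound n (G : topologicalGroupType) q :=
  forall (A : zmodType) (M : discrete_gmodule G A) (c : cochain G A q.+1),
    continuous_cochain c -> cobound M c = 0 -> (forall g, c g *+ n = 0) ->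
  exists2 f : cochain G A q, continuous_cochain f & c = cobound M f.

(** Explicit cochains take the place of a long exact sequence: a cocycle over [A] becomes a cocycle
    of one degree less over [shift G A], with the same exponent, and a primitive of the latter
    yields one of the former. *)
Lemma torsion_cocycles_boundS n (G : topologicalGroupType) q :
  compact [set: G] ->
  torsion_cocycles_bound n G q -> torsion_cocycles_bound n G q.+1.
Proof.
move=> G_compact bound_q A M c /continuous_discreteP lc dc0 cn0.
have dcE x g : M x (c g) = c (pcons (x * g ord0)%g (ptail g))
    + face_sum (fun g => c (pcons x g)) g.
  apply/eqP; rewrite -subr_eq0 opprD addrA -cobound_pcons.
  by rewrite dc0.
(* With e g = c (1, g), the map F g : x |-> c (x, g) - x (e g) is a cocycle with
   values in Ind(A) / A; if it is the coboundary of h and f (x, g) = h g x, then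
   c is the coboundary of e - f. *)
pose e g := c (pcons 1%g g).
(* At [x = 1] the cocycle identity reads [c g = c g + face_sum e g]. *)
have face_e0 g : face_sum e g = 0.
  have := dcE 1%g g; rewrite gact1 mul1g pcons_eta => /eqP.
  by rewrite -subr_eq0 opprD addrA subrr sub0r oppr_eq0 => /eqP.
have lF : locally_constant
    (fun u : G * {ptws 'I_q.+1 -> G} => c (pcons u.1 u.2) - M u.1 (e u.2)).
  have l1 := locally_constant_comp
    (pcons_continuous (@fst_continuous G _) (@snd_continuous _ _)) lc.
  have l2 := gact_locally_constant M (@fst_continuous G {ptws 'I_q.+1 -> G})
    (locally_constant_comp
       (pcons_continuous (@cst_continuous _ _ 1%g) (@snd_continuous _ _)) lc).
  by move=> u; apply: filterS2 (l1 u) (l2 u) => v /= -> ->.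
pose F0 g x := c (pcons x g) - M x (e g).
have lF0 g : locally_constant (F0 g).
  apply: (@locally_constant_comp _ _ _ (fun x => (x, g)) _ _ lF) => x.
  exact: (cvg_pair cvg_id (cvg_cst _)).
have F01 g : F0 g 1%g = 0 by rewrite /F0 gact1 subrr.
pose F : cochain G (shift G A) q.+1 := fun g => shift_fun (lF0 g) (F01 g).
have [] := bound_q _ (shift_module M G_compact) F.
- apply/continuous_discreteP => g.
  apply: filterS (locally_constant_curry G_compact lF g) => g' E.
  by apply: shift_inj => x; move/(congr1 (@^~ x)): E.
- apply/funext => g; apply: shift_inj => x.
  rewrite coboundE -[RHS]/(0 : A).
  rewrite -[LHS]/(shift_act_fun M (g ord0) (F (ptail g)) x + face_sum F g x).
  rewrite /shift_act_fun face_sum_shift /= /F0 face_sumB -/e.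
  (* The terms in [e] all disappear, and what is left is the cocycle identity [dcE]. *)
  have -> : face_sum (fun g => M x (e g)) g = 0.
    by rewrite -(raddf_face_sum (M x)) face_e0 raddf0.
  rewrite gactB -gactM subr0 pcons_eta dcE !opprB opprD.
  by rewrite -!addrA addNr addr0 addKr subrr.
- move=> g; apply: shift_inj => x.
  rewrite -[LHS]/(shift_eval x _) raddfMn /= /shift_eval /= /F0 mulrnBl.
  by rewrite -gactMn !cn0 gact0 subr0.
move=> h /continuous_discreteP lh Fh.
pose f : cochain G A q.+1 := fun g => h (ptail g) (g ord0).
exists (e - f).
  apply: continuous_cochainB; apply/continuous_discreteP.
    apply: (locally_constant_comp _ lc).
    exact: pcons_continuous (@cst_continuous _ _ 1%g) (@id_continuous _).
  move=> g; have [lhg _] := shiftP (h (ptail g)).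
  have l1 := locally_constant_comp (@ptail_continuous G q) lh g.
  have l2 := locally_constant_comp (@ptws_proj_continuous 'I_q.+1 G ord0) lhg g.
  by apply: filterS2 l1 l2 => g' /= E1 E2; rewrite /f E1.
rewrite coboundB; apply/funext => g.
rewrite -(pcons_eta g); move: (g ord0) (ptail g) => {}x {}g.
rewrite -[RHS]/(cobound M e (pcons x g) - cobound M f (pcons x g)).
have -> : cobound M e (pcons x g) = M x (e g).
  by rewrite coboundE pcons0 pconsK face_e0 addr0.
have : F g x = cobound (shift_module M G_compact) h g x by rewrite Fh.
rewrite coboundE.
rewrite -[RHS]/(shift_act_fun M (g ord0) (h (ptail g)) x + face_sum h g x).
rewrite /shift_act_fun face_sum_shift -[LHS]/(F0 g x) /F0 => /eqP.
rewrite subr_eq addrC => /eqP ->; congr (_ + _).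
rewrite cobound_pcons /f pcons0 pconsK.
by rewrite opprD opprK opprB; congr (_ + face_sum _ _); apply/funext => k;
  rewrite pconsK pcons0.
Qed.

(** * Finite quotients and extensions as profinite groups *)

Section DiscreteGroup.
Variable H : groupType.

HB.instance Definition _ := monoid.Group.copy (discrete_topology H) H.

Lemma discrete_mulg_continuous :
  continuous (fun x : discrete_topology H * discrete_topology H => x.1 * x.2)%g.
Proof.
apply: locally_constant_continuous => -[x y].
exists ([set x : discrete_topology H], [set y : discrete_topology H]).
  by split; exact: discrete_set1.
by move=> [x' y'] /= [-> ->].
Qed.

Lemma discrete_invg_continuous :
  continuous (fun x : discrete_topology H => x^-1)%g.
Proof.
apply: locally_constant_continuous => x.
exact: (@discrete_nbhs (discrete_topology H)).
Qed.

HB.instance Definition _ := PreTopologicalGroup_isTopologicalGroup.Build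
  (discrete_topology H) discrete_mulg_continuous discrete_invg_continuous.

Hypothesis H_finite : finite_set [set: H].

Lemma discrete_totally_disconnected :
  totally_disconnected [set: discrete_topology H].
Proof.
apply: zero_dimension_totally_disconnected => x y /eqP xy.
exists [set x]; split=> //; last by move=> /esym.
by split; [exact: discrete_open|exact: discrete_closed].
Qed.

Definition discrete_profinite : profiniteGroupType :=
  HB.pack_for profiniteGroupType (discrete_topology H)
    (TopologicalGroup_isProfinite.Build (discrete_topology H)
      (finite_compact (H_finite : finite_set [set: discrete_topology H]))
      discrete_hausdorff discrete_totally_disconnected).

End DiscreteGroup.

(** * Finite quotient groups attached to locally constant maps *)

Section SyntacticQuotient.
Variables (G : groupType) (T : Type) (w : G -> T).

(* The coarsest congruence on G that is compatible with w. *)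
Definition syntactic : rel G :=
  fun g h => `[< forall x y, w (x * g * y)%g = w (x * h * y)%g >].

Lemma syntacticP g h :
  reflect (forall x y, w (x * g * y)%g = w (x * h * y)%g) (syntactic g h).
Proof. exact: asboolP. Qed.

Lemma syntactic_refl : reflexive syntactic.
Proof. by move=> g; apply/syntacticP. Qed.

Lemma syntactic_sym : symmetric syntactic.
Proof.
by move=> g h; apply/syntacticP/syntacticP => E x y; rewrite E.
Qed.

Lemma syntactic_trans : transitive syntactic.
Proof.
by move=> g h k /syntacticP E /syntacticP F; apply/syntacticP => x y; rewrite E.
Qed.

Canonical syntactic_equiv :=
  EquivRel syntactic syntactic_refl syntactic_sym syntactic_trans.

Definition syntactic_quotient := {eq_quot syntactic}%qT.

HB.instance Definition _ := EqQuotient.on syntactic_quotient.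
HB.instance Definition _ := Choice.on syntactic_quotient.

Definition syntactic_pi (g : G) : syntactic_quotient := \pi_syntactic_quotient%qT g.

Definition syntactic_mul (a b : syntactic_quotient) : syntactic_quotient :=
  syntactic_pi (repr a * repr b)%g.

Definition syntactic_inv (a : syntactic_quotient) : syntactic_quotient :=
  syntactic_pi (repr a)^-1%g.

Lemma syntactic_piP g h :
  reflect (syntactic_pi g = syntactic_pi h) (syntactic g h).
Proof. exact: eqmodP. Qed.

End SyntacticQuotient.

Section SyntacticGroup.
Variables (G : groupType) (T : Type) (w : G -> T).
Local Notation Q := (syntactic_quotient w).
Local Notation pi := (syntactic_pi w).

Lemma syntactic_reprK (a : Q) : pi (repr a) = a.
Proof. exact: reprK. Qed.

Lemma syntactic_repr g : syntactic w (repr (pi g)) g.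
Proof. by apply/syntactic_piP; rewrite syntactic_reprK. Qed.

Lemma syntactic_mulE g h : syntactic_mul (pi g) (pi h) = pi (g * h)%g.
Proof.
apply/syntactic_piP/syntacticP => x y.
have /syntacticP Eg := syntactic_repr g; have /syntacticP Eh := syntactic_repr h.
by rewrite mulgA Eh -mulgA Eg !mulgA.
Qed.

Lemma syntactic_invE g : syntactic_inv (pi g) = pi g^-1%g.
Proof.
apply/syntactic_piP/syntacticP => x y.
have /syntacticP/(_ (x * (repr (pi g))^-1) (g^-1 * y))%g := syntactic_repr g.
by rewrite mulgVK !mulgA mulgK.
Qed.

Fact syntactic_mulgA : associative (@syntactic_mul G T w).
Proof.
move=> a b c; rewrite -(syntactic_reprK a) -(syntactic_reprK b).
by rewrite -(syntactic_reprK c) !syntactic_mulE mulgA.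
Qed.

Fact syntactic_mul1g : left_id (pi 1%g) (@syntactic_mul G T w).
Proof. by move=> a; rewrite -(syntactic_reprK a) syntactic_mulE mul1g. Qed.

Fact syntactic_mulg1 : right_id (pi 1%g) (@syntactic_mul G T w).
Proof. by move=> a; rewrite -(syntactic_reprK a) syntactic_mulE mulg1. Qed.

Fact syntactic_mulVg :
  left_inverse (pi 1%g) (@syntactic_inv G T w) (@syntactic_mul G T w).
Proof.
by move=> a; rewrite -(syntactic_reprK a) syntactic_invE syntactic_mulE mulVg.
Qed.

Fact syntactic_mulgV :
  right_inverse (pi 1%g) (@syntactic_inv G T w) (@syntactic_mul G T w).
Proof.
by move=> a; rewrite -(syntactic_reprK a) syntactic_invE syntactic_mulE mulgV.
Qed.

HB.instance Definition _ := monoid.isGroup.Build Q syntactic_mulgA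
  syntactic_mul1g syntactic_mulg1 syntactic_mulVg syntactic_mulgV.

Lemma syntactic_piM : {morph pi : g h / (g * h)%g}.
Proof. by move=> g h; rewrite -[RHS]/(syntactic_mul (pi g) (pi h)) syntactic_mulE. Qed.

Lemma syntactic_pi_eq g h : pi g = pi h -> w g = w h.
Proof.
by move=> /syntactic_piP/syntacticP/(_ 1 1)%g; rewrite !mul1g !mulg1.
Qed.

End SyntacticGroup.

Section SyntacticFinite.
Variables (G : topologicalGroupType) (T : Type) (w : G -> T).
Hypothesis G_compact : compact [set: G].
Hypothesis w_lc : locally_constant w.

(** By the tube lemma over the compact space [G * G], the value [w (x * g * y)] is locally constant
    in [g] uniformly in [x] and [y]. Hence [w] factors through a finite quotient group, and no open
    normal subgroup has to be chosen. *)
Lemma syntactic_pi_locally_constant : locally_constant (syntactic_pi w).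
Proof.
have l : locally_constant (fun u : (G * G) * G => w (u.1.1 * u.2 * u.1.2)%g).
  apply: (locally_constant_comp _ w_lc).
  have c1 : continuous (fun u : (G * G) * G => u.1.1).
    move=> u; apply: (@continuous_comp _ _ _ fst fst); exact: fst_continuous.
  have c2 : continuous (fun u : (G * G) * G => u.1.2).
    move=> u; apply: (@continuous_comp _ _ _ fst snd).
      exact: fst_continuous.
    exact: snd_continuous.
  exact: continuous_mulg (continuous_mulg c1 (@snd_continuous _ _)) c2.
move=> g; apply: filterS
  (locally_constant_curry (compact_prodT G_compact G_compact) l g).
move=> h E; apply/syntactic_piP/syntacticP => x y.
by move/(congr1 (@^~ (x, y))): E.
Qed.

Lemma syntactic_finite : finite_set [set: syntactic_quotient w].
Proof.
apply: sub_finite_set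
  (locally_constant_finite_range G_compact syntactic_pi_locally_constant).
by move=> a _; exists (repr a) => //; exact: syntactic_reprK.
Qed.

End SyntacticFinite.

(* For the group extension of H by B defined by a 2-cocycle; the cocycle is
   not assumed to be normalised. *)
Record extension_data (B : zmodType) (H : groupType) := ExtensionData {
  ext_act : H -> B -> B;
  ext_cocycle : H -> H -> B;
  ext_act1 : forall a, ext_act 1%g a = a;
  ext_actM : forall g h a, ext_act (g * h)%g a = ext_act g (ext_act h a);
  ext_actD : forall g a b, ext_act g (a + b) = ext_act g a + ext_act g b;
  ext_cocycleP : forall g h k,
    ext_cocycle g h + ext_cocycle (g * h)%g k
    = ext_act g (ext_cocycle h k) + ext_cocycle g (h * k)%g
}.

(** Keeping the data as a parameter ties the twisted group law to the type, apart from the plain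
    product. *)
Definition extension_type B H (_ : extension_data B H) : Type := (B * H)%type.

Section Extension.
Variables (B : zmodType) (H : groupType) (E : extension_data B H).
Local Notation act := (ext_act E).
Local Notation c := (ext_cocycle E).

HB.instance Definition _ := Choice.copy (extension_type E) (B * H)%type.
Local Notation extension := (extension_type E).

Definition extension_mul (u v : extension) : extension :=
  (u.1 + act u.2 v.1 + c u.2 v.2, u.2 * v.2)%g.

(** For a cocycle that is not normalised, [c 1 g = c 1 1] and [c g 1 = g (c 1 1)]; the correction
    [- c 1 1] cancels both. *)
Definition extension_one : extension := (- c 1%g 1%g, 1%g).

Definition extension_inv (u : extension) : extension :=
  (- c 1%g 1%g - act u.2^-1%g u.1 - c u.2^-1%g u.2, u.2^-1)%g.

Lemma ext_act0 g : act g 0 = 0.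
Proof. by apply: (addIr (act g 0)); rewrite -ext_actD !add0r. Qed.

Lemma ext_actN g a : act g (- a) = - act g a.
Proof. by apply: (addIr (act g a)); rewrite -ext_actD !addNr ext_act0. Qed.

Lemma ext_cocycle1g g : c 1%g g = c 1%g 1%g.
Proof.
have := ext_cocycleP E 1%g 1%g g; rewrite !mul1g ext_act1 => /addIr.
by move=> ->.
Qed.

Lemma ext_cocycleg1 g : c g 1%g = act g (c 1%g 1%g).
Proof. by have := ext_cocycleP E g 1%g 1%g; rewrite !mulg1 => /addIr. Qed.

Fact extension_mulgA : associative extension_mul.
Proof.
move=> [a g] [b h] [d k]; rewrite /extension_mul /= mulgA; congr pair.
rewrite !ext_actD ext_actM -!addrA; congr (_ + (_ + _)).
by rewrite -ext_cocycleP addrCA.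
Qed.

Fact extension_mul1g : left_id extension_one extension_mul.
Proof.
move=> [b h]; rewrite /extension_mul /= mul1g; congr pair.
by rewrite ext_act1 ext_cocycle1g addrAC addNr add0r.
Qed.

Fact extension_mulg1 : right_id extension_one extension_mul.
Proof.
move=> [b h]; rewrite /extension_mul /= mulg1; congr pair.
by rewrite ext_actN (ext_cocycleg1 h) subrK.
Qed.

Fact extension_mulVg : left_inverse extension_one extension_inv extension_mul.
Proof.
move=> [b h]; rewrite /extension_mul /extension_inv /= mulVg; congr pair.
by rewrite -!addrA (addrCA (- c h^-1%g h)) addNr addr0 addNr addr0.
Qed.

Fact extension_mulgV : right_inverse extension_one extension_inv extension_mul.
Proof.
move=> [b h]; rewrite /extension_mul /extension_inv /= mulgV; congr pair.
rewrite !ext_actD !ext_actN -ext_actM mulgV ext_act1.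
have := ext_cocycleP E h h^-1%g h.
rewrite mulVg mulgV (ext_cocycle1g h) (ext_cocycleg1 h) => /(canRL (addrK _)) ->.
by rewrite [- act h _ - b]addrC -!addrA addNKr !addKr.
Qed.

HB.instance Definition _ := monoid.isGroup.Build extension extension_mulgA
  extension_mul1g extension_mulg1 extension_mulVg extension_mulgV.

Lemma extension_mulE (u v : extension) :
  (u * v)%g = (u.1 + act u.2 v.1 + c u.2 v.2, u.2 * v.2)%g :> extension.
Proof. by []. Qed.

(** On the kernel the shift [a |-> a + c 1 1] is an isomorphism onto [B], so the kernel has the same
    exponent as [B] and the extension poses a p-embedding problem. *)
Lemma extension_kerX (a : B) n :
  (((a, 1%g) : extension) ^+ n)%g =
  ((a + c 1%g 1%g) *+ n - c 1%g 1%g, 1%g) :> extension.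
Proof.
elim: n => [|n IHn]; first by rewrite expg0 mulr0n sub0r.
rewrite expgS IHn extension_mulE /= ext_act1 mulg1; congr pair.
by rewrite addrA subrK mulrS addrAC addrK.
Qed.

Definition extension_snd (u : extension) : H := u.2.

Lemma extension_finite : finite_set [set: B] -> finite_set [set: H] ->
  finite_set [set: extension].
Proof. by move=> fB fH; rewrite -[setT]setXTT; exact: finite_setX. Qed.

End Extension.

(** Here [b] is the first component of a proper solution for the projection of the extension onto
    [H]. For the zero cocycle it is a crossed homomorphism, and surjectivity is what matters; in
    general its equation makes the cocycle, pulled back to [Pi], a coboundary. *)
Lemma split_extension_embedding (p k : nat) (Pi : profiniteGroupType)
    (B : zmodType) (H : groupType) (E : extension_data B H) (pi : Pi -> H) :
  (forall E : embedding_problem Pi,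
     finite_ep E -> p_ep p E -> has_proper_solution E) ->
  finite_set [set: B] -> (forall b : B, b *+ (p ^ k) = 0) ->
  finite_set [set: H] -> {morph pi : x y / (x * y)%g} ->
  locally_constant pi -> (forall h, exists x, pi x = h) ->
  exists b : Pi -> B, [/\ locally_constant b,
    forall x y, b (x * y)%g
      = b x + ext_act E (pi x) (b y) + ext_cocycle E (pi x) (pi y) &
    forall a, exists x, b x = a].
Proof.
move=> solvable fB Bp fH piM pi_lc pi_surj.
pose Gam := discrete_profinite (extension_finite E fB fH).
pose G := discrete_profinite fH.
pose alpha := HB.pack_for {multiplicative Pi -> G} (pi : Pi -> G)
  (monoid.isMultiplicative.Build Pi G (pi : Pi -> G) piM).
have fM : {morph (@extension_snd B H E : Gam -> G) : x y / (x * y)%g} by [].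
pose f := HB.pack_for {multiplicative Gam -> G} (@extension_snd B H E : Gam -> G)
  (monoid.isMultiplicative.Build Gam G (@extension_snd B H E) fM).
have alpha_c : continuous alpha by exact: locally_constant_continuous.
have f_c : continuous f.
  apply: locally_constant_continuous => x.
  exact: (@discrete_nbhs (discrete_topology (extension_type E))).
have alpha_s : range alpha = [set: G].
  by apply/seteqP; split=> // h _; have [x <-] := pi_surj h; exists x.
have f_s : range f = [set: G].
  by apply/seteqP; split=> // h _; exists ((0, h) : extension_type E).
have [||beta [beta_c beta_s fbeta]] :=
    solvable (EmbeddingProblem alpha_c f_c alpha_s f_s).
- exact: extension_finite.
- move=> [a h] /= h1; exists k.
  have {h1}-> : h = 1%g by [].
  change ((((a, 1%g) : extension_type E) ^+ (p ^ k))%g = 1%g).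
  by rewrite extension_kerX Bp sub0r.
have beta2 x : (beta x : extension_type E).2 = pi x by exact: fbeta.
have beta_lc : locally_constant (beta : Pi -> extension_type E).
  apply: (@continuous_locally_constant _ (discrete_topology (extension_type E))) beta_c.
  exact: discrete_set1.
exists (fun x => (beta x : extension_type E).1); split.
- exact: (locally_constant_post fst beta_lc).
- by move=> x y; rewrite -!beta2 gmulfM.
- move=> a; have : [set: Gam] ((a, 1%g) : extension_type E) by [].
  by rewrite -beta_s => -[x _ E1]; exists x; rewrite E1.
Qed.

(** * Cohomology in low degree *)

Section LowDegree.
Variables (G : topologicalGroupType) (A : zmodType) (M : discrete_gmodule G A).

Definition pnil : {ptws 'I_0 -> G} := fun=> 1%g.
Definition point1 (x : G) : {ptws 'I_1 -> G} := pcons x pnil.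
Definition point2 (x y : G) : {ptws 'I_2 -> G} := pcons x (point1 y).
Definition point3 (x y z : G) : {ptws 'I_3 -> G} := pcons x (point2 y z).

Lemma pnil_eta (g : {ptws 'I_0 -> G}) : g = pnil.
Proof. by apply/funext => -[]. Qed.

Lemma point1_ord0 x : point1 x ord0 = x.
Proof. exact: pcons0. Qed.

Lemma ptail_point1 x : ptail (point1 x) = pnil.
Proof. exact: pconsK. Qed.

Lemma point1_eta (g : {ptws 'I_1 -> G}) : g = point1 (g ord0).
Proof. by rewrite /point1 -(pnil_eta (ptail g)) pcons_eta. Qed.

Lemma point2_ord0 x y : point2 x y ord0 = x.
Proof. exact: pcons0. Qed.

Lemma ptail_point2 x y : ptail (point2 x y) = point1 y.
Proof. exact: pconsK. Qed.

Lemma point2_eta (g : {ptws 'I_2 -> G}) : g = point2 (g ord0) (ptail g ord0).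
Proof. by rewrite /point2 -point1_eta pcons_eta. Qed.

Lemma point3_eta (g : {ptws 'I_3 -> G}) :
  g = point3 (g ord0) (ptail g ord0) (ptail (ptail g) ord0).
Proof. by rewrite /point3 -point2_eta pcons_eta. Qed.

Lemma point1_continuous : continuous point1.
Proof. exact: pcons_continuous (@id_continuous G) (@cst_continuous _ _ pnil). Qed.

Lemma point2_continuous : continuous (fun u : G * G => point2 u.1 u.2).
Proof.
apply: pcons_continuous (@fst_continuous G G) _ => u.
by apply: (@continuous_comp _ _ _ snd point1);
  [exact: snd_continuous|exact: point1_continuous].
Qed.

Lemma face_sum_point1 (B : zmodType) (f : {ptws 'I_0 -> G} -> B) x :
  face_sum f (point1 x) = - f pnil.
Proof. by rewrite /face_sum big_ord0 add0r expr1 mulrN1z (pnil_eta (pinit _)). Qed.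

Lemma face_sum_point2 (B : zmodType) (f : {ptws 'I_1 -> G} -> B) x y :
  face_sum f (point2 x y) = - f (point1 (x * y)%g) + f (point1 x).
Proof.
by rewrite face_sum_pcons face_sum_point1 opprK point1_ord0 ptail_point1.
Qed.

Lemma cobound_point1 (f : cochain G A 0) x :
  cobound M f (point1 x) = M x (f pnil) - f pnil.
Proof. by rewrite coboundE face_sum_point1 point1_ord0 ptail_point1. Qed.

Lemma cobound_point2 (f : cochain G A 1) x y :
  cobound M f (point2 x y) =
  M x (f (point1 y)) - f (point1 (x * y)%g) + f (point1 x).
Proof. by rewrite coboundE face_sum_point2 point2_ord0 ptail_point2 addrA. Qed.

Lemma cobound_point3 (f : cochain G A 2) x y z :
  cobound M f (point3 x y z) =
  M x (f (point2 y z)) - f (point2 (x * y)%g z) + f (point2 x (y * z)%g)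
  - f (point2 x y).
Proof.
rewrite cobound_pcons face_sum_point2 point2_ord0 ptail_point2 opprD opprK.
by rewrite addrA.
Qed.

Definition cochain1 (b : G -> A) : cochain G A 1 := fun g => b (g ord0).

Lemma cochain1K b x : cochain1 b (point1 x) = b x.
Proof. by rewrite /cochain1 point1_ord0. Qed.

Lemma cochain1_eta (f : cochain G A 1) : f = cochain1 (f \o point1).
Proof. by apply/funext => g; rewrite /cochain1 /= -point1_eta. Qed.

Lemma cochain1_continuous b :
  continuous_cochain (cochain1 b) <-> locally_constant b.
Proof.
split=> [/continuous_discreteP lb|lb]; last first.
  apply/continuous_discreteP.
  exact: (locally_constant_comp (@ptws_proj_continuous 'I_1 G ord0) lb).
apply: (locally_constant_ext _ (locally_constant_comp point1_continuous lb)).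
exact: cochain1K.
Qed.

Definition crossed_hom : set (G -> A) :=
  [set b | locally_constant b /\ forall x y, b (x * y)%g = b x + M x (b y)].

Lemma cocycle1P (f : cochain G A 1) :
  reflect (crossed_hom (f \o point1)) (f \in is_cocycle M (q := 1)).
Proof.
apply: (iffP (asboolP _)) => -[].
  move=> cf df0; split; first by apply/cochain1_continuous; rewrite -cochain1_eta.
  move=> x y /=; have := cobound_point2 f x y; rewrite df0 => /esym/eqP.
  by rewrite addrAC subr_eq0 addrC => /eqP <-.
move=> lf fM; split; first by rewrite (cochain1_eta f); apply/cochain1_continuous.
apply/funext => g; rewrite (point2_eta g) cobound_point2.
by rewrite [f (point1 (_ * _)%g)]fM /= opprD addrA addrAC addrNK addrN.
Qed.

Lemma cohomology_eq0 q (z : cocycle M q.+1) :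
  \pi_(cohomology M q.+1)%qT z = 0 <->
  exists2 f : cochain G A q, continuous_cochain f & \val z = cobound M f.
Proof.
have -> : 0 = \pi_(cohomology M q.+1)%qT 0 by rewrite raddf0.
split=> [/eqP|zf].
  by rewrite -Quotient.idealrBE subr0 => /asboolP.
by apply/eqP; rewrite -Quotient.idealrBE subr0; apply/asboolP.
Qed.

End LowDegree.

(** * From embedding problems to cohomology *)

(** A crossed homomorphism is a representative of its class plus the coboundary of an element of
    [A], and both choices are finite in number; conversely classes are images of crossed
    homomorphisms. *)
Lemma finite_cohomology1 (G : topologicalGroupType) (A : zmodType)
    (M : discrete_gmodule G A) :
  finite_set [set: A] ->
  finite_set [set: cohomology M 1] <-> finite_set (crossed_hom M).
Proof.
move=> fA; split=> [fH|fZ].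
  pose F (u : cohomology M 1 * A) : G -> A := fun x =>
    \val (repr u.1) (point1 x) + (M x u.2 - u.2).
  apply: sub_finite_set (finite_image F (finite_setX fH fA)) => b bP.
  have zP : cochain1 b \in is_cocycle M (q := 1).
    by apply/cocycle1P; rewrite (_ : _ \o _ = b) //; apply/funext => x; exact: cochain1K.
  pose z : cocycle M 1 := Cocycle zP.
  pose a : cohomology M 1 := \pi_(cohomology M 1)%qT z.
  have /cohomology_eq0[f _ zf] : \pi_(cohomology M 1)%qT (z - repr a) = 0.
    by rewrite raddfB /= reprK subrr.
  exists (a, f (pnil G)) => //; apply/funext => x; rewrite /F /=.
  rewrite -cobound_point1 -zf.
  by rewrite [X in _ + X]/(cochain1 b (point1 x) - \val (repr a) (point1 x))
    cochain1K addrC subrK.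
pose F (b : G -> A) : cohomology M 1 :=
  \pi_(cohomology M 1)%qT (insubd (0 : cocycle M 1) (cochain1 b)).
apply: sub_finite_set (finite_image F fZ) => a _.
exists (\val (repr a) \o @point1 G); first by apply/cocycle1P; exact: valP.
by rewrite /F -cochain1_eta valKd reprK.
Qed.

Section Forward.
Variables (p : nat) (Pi : profiniteGroupType).
Hypothesis p_prime : prime p.
Hypothesis solvable : forall E : embedding_problem Pi,
  finite_ep E -> p_ep p E -> has_proper_solution E.

Lemma solvable_strongly_dominating : strongly_dominating p Pi.
Proof.
move=> P M abelP P_gt1 /(finite_cohomology1 M finite_finset)/finite_seqP[s Zs].
have Pp (a : P) : a *+ p = 0.
  have [_ /(_ a)] := abelemP p_prime abelP.
  by rewrite inE FinRing.zmodXgE => ->.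
(* One more than the length of a list of all crossed homomorphisms, so that [N] distinct ones are a
   contradiction. *)
pose N := (size s).+1.
(* [w] records the whole action of [x], so that the action on [P] descends to the finite group
   [H]. *)
pose w (x : Pi) := M x : P -> P.
have w_lc : locally_constant w.
  move=> x; have : \forall y \near x, forall a, M y a = M x a.
    apply: filter_forall => a.
    exact: gact_locally_constant (@id_continuous Pi) (@locally_constant_cst Pi P a) x.
  by apply: filterS => y E; apply/funext.
pose H := syntactic_quotient w.
pose pi : Pi -> H := syntactic_pi w.
pose act (h : H) (b : {ffun 'I_N -> P}) : {ffun 'I_N -> P} :=
  [ffun i => M (repr h) (b i)].
have actE x b i : act (pi x) b i = M x (b i).
  rewrite ffunE.
  have /syntactic_pi_eq/(congr1 (@^~ (b i))) // : pi (repr (pi x)) = pi x.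
  exact: syntactic_reprK.
have pi_surj h : exists x, pi x = h by exists (repr h); exact: syntactic_reprK.
have act1 b : act 1%g b = b.
  by apply/ffunP => i; rewrite -[1%g]/(pi 1%g) actE gact1.
have actM g h b : act (g * h)%g b = act g (act h b).
  have [x <-] := pi_surj g; have [y <-] := pi_surj h.
  by apply/ffunP => i; rewrite -[(_ * _)%g]syntactic_piM !actE gactM.
have actD g a b : act g (a + b) = act g a + act g b.
  by apply/ffunP => i; rewrite !ffunE gactD.
have c0 (g h k : H) : (0 : {ffun 'I_N -> P}) + 0 = act g 0 + 0.
  by apply/ffunP => i; rewrite !ffunE gact0.
pose E := @ExtensionData {ffun 'I_N -> P} H act (fun _ _ => 0) act1 actM actD c0.
have [|b [b_lc bM b_surj]] := @split_extension_embedding p 1 Pi _ H E pi solvable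
   finite_finset _ (syntactic_finite (@profinite_compact Pi) w_lc) 
   (@syntactic_piM _ _ w)
   (syntactic_pi_locally_constant (@profinite_compact Pi) w_lc) pi_surj.
  move=> f; apply/ffunP => i; by rewrite expn1 ffunMnE Pp ffunE.
have bZ i : crossed_hom M (fun x => b x i).
  split; first exact: (locally_constant_post (fun f : {ffun 'I_N -> P} => f i) b_lc).
  by move=> x y; rewrite bM addr0 ffunE actE.
pose bi i := (fun x => b x i) : Pi -> P.
have bi_inj : injective bi.
  move=> i j bij; apply/eqP/negPn/negP => neq_ij.
  have [a /eqP a0] : exists a : P, a <> 0.
    apply: contrapT => /forallNP a0; move: P_gt1.
    rewrite (@eq_card _ _ (pred1 (0 : P))) ?card1// => a.
    by rewrite !inE; apply/esym/eqP; exact: contrapT (a0 a).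
  (* Since [b] is onto, it takes a value whose components at [i] and [j] differ. *)
  have [x bx] := b_surj [ffun k => if k == i then a else 0].
  move/(congr1 (@^~ x)): bij; rewrite /bi bx !ffunE eqxx eq_sym (negbTE neq_ij).
  by move/eqP; rewrite (negbTE a0).
have: (size [seq bi i | i : 'I_N] <= size s)%N.
  apply: uniq_leq_size; first by rewrite map_inj_uniq ?enum_uniq.
  by move=> _ /mapP[i _ ->]; have := bZ i; rewrite Zs.
by rewrite size_map size_enum_ord ltnn.
Qed.

End Forward.

(** * Finite submodules and cocycles of degree 2 *)

Definition subgroup_set (A : zmodType) (D : set A) :=
  D 0 /\ forall a b, D a -> D b -> D (a - b).

(** By induction on the generators: a new generator [a] contributes the multiples [a *+ i], and only
    [i < n] matter. *)
Lemma finite_subgroup_set (A : zmodType) n (s : seq A) :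
  (0 < n)%N -> (forall a, a \in s -> a *+ n = 0) ->
  exists D : set A, [/\ finite_set D, subgroup_set D & [set` s] `<=` D].
Proof.
move=> n_gt0; elim: s => [_|a s IHs san].
  exists [set 0]; split; first exact: finite_set1.
    by split=> // _ _ -> ->; rewrite subr0.
  by move=> x; rewrite /= in_nil.
have [b sb|D [fD [D0 DB] sD]] := IHs; first by apply: san; rewrite inE sb orbT.
pose E := [set u.1 + a *+ u.2 | u in D `*` [set: nat]].
have an : a *+ n = 0 by apply: san; rewrite inE eqxx.
exists E; split.
- pose F (u : A * 'I_n) := u.1 + a *+ u.2.
  apply: sub_finite_set (finite_image F (finite_setX fD (finite_finset (X := setT)))).
  move=> _ [[d i] /= [Dd _] <-].
  exists (d, Ordinal (ltn_pmod i n_gt0)) => //=; rewrite /F /=; congr (_ + _).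
  by rewrite [in RHS](divn_eq i n) mulrnDr mulnC mulrnA an mul0rn add0r.
- split; first by exists (0, 0%N) => //=; rewrite add0r.
  move=> _ _ [[d i] [/= Dd _] <-] [[e j] [/= De _] <-].
  (* As [n] kills [a], the multiple [n.-1 * j] stands for [- j] and keeps the coefficient a natural
     number. *)
  exists (d - e, (i + n.-1 * j)%N); first by split=> //; exact: DB.
  rewrite /= mulrnDr opprD addrACA; congr (_ + (_ + _)).
  apply/eqP; rewrite -subr_eq0 opprK -mulrnDr -mulSnr prednK//.
  by rewrite mulrnA an mul0rn.
- move=> b; rewrite /= inE => /orP[/eqP ->|sb].
    by exists (0, 1%N) => //=; rewrite add0r.
  by exists (b, 0%N) => /=; [split=> //; exact: sD|rewrite mulr0n addr0].
Qed.

Section Subgroup.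
Variables (A : zmodType) (D : set A).
Hypothesis D_subgroup : subgroup_set D.

(** The proof is an argument of the predicate so that the closure instance, which depends on it, can
    be recovered. *)
Definition in_subgroup (_ : subgroup_set D) : {pred A} := fun a => `[< D a >].

Lemma subgroup_zmod_closed : zmod_closed (in_subgroup D_subgroup).
Proof.
case: (D_subgroup) => D0 DB; split; first exact/asboolP.
by move=> a b /asboolP Da /asboolP Db; apply/asboolP; exact: DB.
Qed.

HB.instance Definition _ :=
  GRing.isZmodClosed.Build A (in_subgroup D_subgroup) subgroup_zmod_closed.

Record subgroup_type := SubgroupElt {
  subgroup_val :> A; _ : subgroup_val \in in_subgroup D_subgroup }.
HB.instance Definition _ := [isSub for subgroup_val].
HB.instance Definition _ := [Choice of subgroup_type by <:].
HB.instance Definition _ := [SubChoice_isSubZmodule of subgroup_type by <:].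

Lemma subgroup_valP (b : subgroup_type) : D (subgroup_val b).
Proof. by case: b => a aD; exact: (elimT (asboolP _) aD). Qed.

Definition subgroup_elt a (Da : D a) : subgroup_type :=
  SubgroupElt (introT (asboolP _) Da).

Lemma subgroup_finite : finite_set D -> finite_set [set: subgroup_type].
Proof.
move=> fD; apply: sub_finite_set (finite_image (insubd (0 : subgroup_type)) fD).
by move=> b _; exists (subgroup_val b); [exact: subgroup_valP|exact: valKd].
Qed.

End Subgroup.

Lemma solvable_torsion_cocycles_bound (p k : nat) (Pi : profiniteGroupType) :
  prime p ->
  (forall E : embedding_problem Pi,
     finite_ep E -> p_ep p E -> has_proper_solution E) ->
  torsion_cocycles_bound (p ^ k) Pi 1.
Proof.
move=> p_prime solvable A M c cc dc0 cp.
have Pi_compact : compact [set: Pi] := profinite_compact.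
pose c2 x y := c (point2 x y).
have c2_lc : locally_constant (fun u : Pi * Pi => c2 u.1 u.2).
  apply: (locally_constant_comp (@point2_continuous Pi)).
  exact/continuous_discreteP.
have c2P x y z : c2 x y + c2 (x * y)%g z = M x (c2 y z) + c2 x (y * z)%g.
  have := cobound_point3 M c x y z; rewrite dc0 => /esym/eqP.
  by rewrite subr_eq0 addrAC subr_eq => /eqP.
(* All translates of values of the cocycle: a finite set by compactness, and stable under [Pi]. *)
pose S := range (fun u : Pi * (Pi * Pi) => M u.1 (c2 u.2.1 u.2.2)).
have [s Ss] : exists s : seq A, S = [set` s].
  apply/finite_seqP; apply: locally_constant_finite_range.
    by do 2?apply: compact_prodT.
  exact: gact_locally_constant (@fst_continuous _ _)
    (locally_constant_comp (@snd_continuous _ _) c2_lc).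
have S_stable x a : S a -> S (M x a).
  by move=> [u _ <-]; exists ((x * u.1)%g, u.2) => //=; rewrite gactM.
have Sc x y : S (c2 x y) by exists (1%g, (x, y)) => //=; rewrite gact1.
(* The subgroup generated by [S], as an intersection. It inherits stability and the exponent from
   [S], and it is finite because it lies in a finite subgroup. *)
pose D : set A := [set a | forall D, subgroup_set D -> S `<=` D -> D a].
have D_sub : subgroup_set D.
  split=> [D' [] //|a b Da Db D' D'_sub SD'].
  by case: (D'_sub) => _; apply; [exact: Da|exact: Db].
have D_fin : finite_set D.
  have [||D' [fD' D'_sub sD']] := @finite_subgroup_set A (p ^ k) s.
  - by rewrite expn_gt0 prime_gt0.
  - move=> a sa; have : S a by rewrite Ss.
    by move=> [u _ <-]; rewrite -gactMn cp gact0.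
  by apply: sub_finite_set fD' => a; apply=> //; rewrite Ss.
have Dc x y : D (c2 x y) by move=> D' _; apply.
have D_stable x a : D a -> D (M x a).
  move=> Da D' [D'0 D'B] SD'; apply: (Da [set a | D' (M x a)]).
    by split=> [|a1 a2 /= D1 D2]; rewrite /= ?gact0// gactB; exact: D'B.
  by move=> a1 Sa1; apply: SD'; exact: S_stable.
have Dp a : D a -> a *+ (p ^ k) = 0.
  move=> Da; apply: (Da [set a | a *+ (p ^ k) = 0]).
    by split=> [|a1 a2 /= E1 E2]; rewrite /= ?mul0rn// mulrnBl E1 E2 subr0.
  by move=> _ [u _ <-] /=; rewrite -gactMn cp gact0.
pose B := subgroup_type D_sub.
have fB : finite_set [set: B] := subgroup_finite D_sub D_fin.
(* Besides the action on [B], [w] records the cocycle with [x] in either argument, so that both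
   action and cocycle descend to [H]. *)
pose w (x : Pi) := ((fun b : B => M x (subgroup_val b)), (c2 x, c2^~ x)).
have w_lc : locally_constant w.
  apply: locally_constant_pair; last apply: locally_constant_pair.
  - apply: (locally_constant_curry (X := discrete_topology B)
      (f := fun u => M u.2 (subgroup_val u.1))).
      exact: finite_compact.
    apply: gact_locally_constant; first exact: snd_continuous.
    have val_lc : locally_constant (@subgroup_val A D D_sub : discrete_topology B -> A).
      by move=> b; exact: (@discrete_nbhs (discrete_topology B)).
    exact: (locally_constant_comp (@fst_continuous _ Pi) val_lc).
  - apply: (locally_constant_curry (f := fun u => c2 u.2 u.1) Pi_compact).
    apply: (locally_constant_comp (h := fun u : Pi * Pi => (u.2, u.1)) _ c2_lc).
    by move=> u; apply: cvg_pair; [exact: snd_continuous|exact: fst_continuous].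
  - exact: (locally_constant_curry (f := fun u => c2 u.1 u.2) Pi_compact).
pose H := syntactic_quotient w; pose pi : Pi -> H := syntactic_pi w.
have pi_surj h : exists x, pi x = h by exists (repr h); exact: syntactic_reprK.
have w_repr x : w (repr (pi x)) = w x.
  by apply: syntactic_pi_eq; exact: syntactic_reprK.
pose act (h : H) (b : B) : B := subgroup_elt D_sub (D_stable (repr h) _ (subgroup_valP b)).
pose cH (g h : H) : B := subgroup_elt D_sub (Dc (repr g) (repr h)).
have actE x b : subgroup_val (act (pi x) b) = M x (subgroup_val b).
  by have [/(congr1 (@^~ b))] := w_repr x.
have cHE x y : subgroup_val (cH (pi x) (pi y)) = c2 x y.
  rewrite /=; have [_ /(congr1 (@^~ (repr (pi y)))) -> _] := w_repr x.
  by have [_ _ /(congr1 (@^~ x))] := w_repr y.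
have act1 b : act 1%g b = b.
  by apply: val_inj; rewrite -[1%g]/(pi 1%g) [LHS]actE gact1.
have actM g h b : act (g * h)%g b = act g (act h b).
  have [x <-] := pi_surj g; have [y <-] := pi_surj h.
  by apply: val_inj; rewrite -syntactic_piM [LHS]actE [RHS]actE actE gactM.
have actD g a b : act g (a + b) = act g a + act g b.
  by apply: val_inj; exact: gactD.
have cHP (g h l : H) : cH g h + cH (g * h)%g l = act g (cH h l) + cH g (h * l)%g.
  have [x <-] := pi_surj g; have [y <-] := pi_surj h; have [z <-] := pi_surj l.
  apply: val_inj; rewrite -!syntactic_piM.
  rewrite -[LHS]/(subgroup_val (cH (pi x) (pi y))
    + subgroup_val (cH (pi (x * y)%g) (pi z))).
  rewrite -[RHS]/(subgroup_val (act (pi x) (cH (pi y) (pi z)))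
    + subgroup_val (cH (pi x) (pi (y * z)%g))).
  by rewrite actE !cHE.
pose E := ExtensionData act1 actM actD cHP.
have [|b [b_lc bM _]] := @split_extension_embedding p k Pi _ H E pi solvable
   fB _ (syntactic_finite Pi_compact w_lc) (@syntactic_piM _ _ w)
   (syntactic_pi_locally_constant Pi_compact w_lc) pi_surj.
  move=> b; apply: val_inj; rewrite raddfMn /=; exact: Dp (subgroup_valP b).
(* The equation for [b] says that its coboundary is minus the cocycle, hence the sign. *)
exists (cochain1 (fun x => - subgroup_val (b x))).
  apply/cochain1_continuous.
  exact: (locally_constant_post (fun b : B => - subgroup_val b) b_lc).
apply/funext => g; rewrite (point2_eta g); move: (g ord0) (ptail g ord0) => x y.
have bE : subgroup_val (b (x * y)%g)
    = subgroup_val (b x) + M x (subgroup_val (b y)) + c2 x y.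
  by rewrite bM -cHE -actE.
rewrite cobound_point2 !cochain1K bE gactN opprK addrC addrA.
by rewrite [in RHS](addrC _ (M x _)) -!addrA !addKr.
Qed.

(** * Reduction of the cohomological dimension to cocycles of p-power exponent *)

Lemma common_exponent (A : zmodType) (s : seq A) :
  (forall a : A, exists2 m, (0 < m)%N & a *+ m = 0) ->
  exists2 m, (0 < m)%N & forall a, a \in s -> a *+ m = 0.
Proof.
move=> tors; elim: s => [|a s [m m_gt0 sm]]; first by exists 1%N.
have [n n_gt0 an] := tors a; exists (n * m)%N; first by rewrite muln_gt0 n_gt0.
move=> b; rewrite inE => /orP[/eqP->|/sm bm]; first by rewrite mulrnA an mul0rn.
by rewrite mulnC mulrnA bm mul0rn.
Qed.

Lemma cocycleMnE (G : topologicalGroupType) (A : zmodType)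
    (M : discrete_gmodule G A) q (z : cocycle M q) n g :
  \val (z *+ n) g = \val z g *+ n.
Proof.
elim: n => [|n IHn] //.
by rewrite !mulrS -IHn.
Qed.

(** A continuous cocycle on a compact group has finitely many values, hence an exponent [m].
    Multiplying it by the part of [m] prime to [p] leaves a p-power exponent, and on a class killed
    by [p ^ k] this multiplication can be undone. *)
Lemma cd_le_torsion_cocycles_bound (p n : nat) (G : topologicalGroupType) :
  prime p -> compact [set: G] ->
  (forall k, torsion_cocycles_bound (p ^ k) G n) -> cd_le p G n.
Proof.
move=> p_prime G_compact bound_n A M tors [//|q] n_lt c [k ck].
have bound_q l : torsion_cocycles_bound (p ^ l) G q.
  rewrite -(subnK (n_lt : n <= q)%N).
  by elim: (q - n)%N => // j IHj; exact: torsion_cocycles_boundS.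
pose z : cocycle M q.+1 := repr c.
have /asboolP[z_cont _] := valP z.
have /finite_seqP[s zs] := locally_constant_finite_range
  (@compact_ptws 'I_q.+1 G G_compact) ((continuous_discreteP _).1 z_cont).
have [m m_gt0 sm] := common_exponent s tors.
have [m' pm' mE] := pfactor_coprime p_prime m_gt0.
have m'_gt0 : (0 < m')%N by move: m_gt0; rewrite mE; case: (m').
(* Bezout: [u * m'] is 1 modulo [p ^ k], so multiplication by it fixes [c]. *)
have [u v uv _] := egcdnP (p ^ k) m'_gt0.
have /eqP gcd1 : coprime m' (p ^ k) by rewrite coprime_sym coprimeXl.
have -> : c = c *+ (u * m').
  by rewrite uv gcd1 mulrnDr mulnC mulrnA ck mul0rn add0r.
rewrite -[c]reprK -raddfMn /=; apply/cohomology_eq0.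
have /asboolP[zm_cont zm0] := valP (z *+ (u * m')).
have [g|f f_cont zf] := bound_q (logn p m) A M _ zm_cont zm0.
  rewrite cocycleMnE -mulrnA -mulnA -mE mulnC mulrnA sm ?mul0rn//.
  by have : [set` s] (\val z g) by rewrite -zs; exists g.
by exists f.
Qed.

Lemma solvable_cd_le (p : nat) (Pi : profiniteGroupType) :
  prime p ->
  (forall E : embedding_problem Pi,
     finite_ep E -> p_ep p E -> has_proper_solution E) ->
  cd_le p Pi 1.
Proof.
move=> p_prime solvable; apply: cd_le_torsion_cocycles_bound => //.
  exact: profinite_compact.
by move=> k; exact: solvable_torsion_cocycles_bound.
Qed.

(** * From cohomology to embedding problems *)

(** When [c] is the factor set of a set-theoretic section of an extension, [h] is the correction
    that turns the section into a homomorphism. Since [p] kills [A], the class of [c] is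
    p-primary. *)
Lemma cd_le1_split (p : nat) (G : topologicalGroupType) (A : zmodType)
    (M : discrete_gmodule G A) (c : G -> G -> A) :
  prime p -> cd_le p G 1 -> (forall a : A, a *+ p = 0) ->
  locally_constant (fun u : G * G => c u.1 u.2) ->
  (forall x y z, c x y + c (x * y)%g z = M x (c y z) + c x (y * z)%g) ->
  exists2 h : G -> A, locally_constant h &
    forall x y, h (x * y)%g = h x + M x (h y) + c x y.
Proof.
move=> p_prime cd1 Ap c_lc cP.
pose C : cochain G A 2 := fun g => c (g ord0) (ptail g ord0).
have CE x y : C (point2 x y) = c x y.
  by rewrite /C ptail_point2 point1_ord0 point2_ord0.
have zP : C \in is_cocycle M (q := 2).
  apply/asboolP; split.
    apply/continuous_discreteP; apply: (@locally_constant_comp _ _ _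
      (fun g : {ptws 'I_2 -> G} => (g ord0, ptail g ord0)) _ _ c_lc).
    exact: (continuous_pair (@ptws_proj_continuous 'I_2 G ord0)
      (@ptws_proj_continuous 'I_2 G (lift ord0 ord0))).
  apply/funext => g; rewrite (point3_eta g) cobound_point3 !CE.
  by rewrite [X in X - _]addrAC -cP addrK subrr.
have [] := (cohomology_eq0 (Cocycle zP)).1 _.
  apply: (cd1 A M _ 2%N) => //.
    by move=> a; exists p; rewrite ?prime_gt0.
  exists 1%N; rewrite -raddfMn /=.
  have -> : Cocycle zP *+ (p ^ 1) = 0; last by rewrite raddf0.
  by apply: val_inj; apply/funext => g; rewrite cocycleMnE expn1 Ap.
move=> f /continuous_discreteP f_lc /= Cf; exists (fun x => - f (point1 x)).
  exact: (locally_constant_post (fun a => - a)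
    (locally_constant_comp (@point1_continuous G) f_lc)).
move=> x y; rewrite -CE Cf cobound_point2 gactN.
by rewrite -!addrA addKr addrCA addNr addr0.
Qed.

(** The intersection is normalised by [H], and by [N] because [N] is abelian, hence by [G]. By
    minimality it is trivial or all of [N], and in the latter case [N * H] lies in [H]. *)
Lemma minnormal_cap (gT : finGroupType) (G N H : {group gT}) :
  minnormal N G -> abelian N -> H \subset G -> G \subset (N * H)%g ->
  (H :&: N = 1)%g \/ G \subset H.
Proof.
move=> minN abN sHG sGNH; have [/andP[ntN nNG] minN'] := mingroupP minN.
have [->|ntHN] := eqVneq (H :&: N)%g 1%g; [by left|right].
have nHN : G \subset 'N(H :&: N)%g.
  apply: (fintype.subset_trans sGNH); apply: mul_subG.
    exact: sub_abelian_norm abN (finset.subsetIr _ _).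
  exact: normsI (normG H) (fintype.subset_trans sHG nNG).
have NE : (H :&: N)%G = N.
  by apply/val_inj; apply: minN'; rewrite /= ?ntHN ?finset.subsetIr.
apply: (fintype.subset_trans sGNH); rewrite mul_subG //.
by rewrite -NE finset.subsetIl.
Qed.

(** The two elements differ by a factor in [N], which commutes with [v]. Thus conjugation through a
    section that is not multiplicative still gives an action. *)
Lemma conjg_eq_mod_abelian (gT : finGroupType) (N : {group gT}) (g h v : gT) :
  abelian N -> g \in 'N(N)%g -> h \in 'N(N)%g -> coset N g = coset N h ->
  v \in N -> (v ^ g = v ^ h)%g.
Proof.
move=> abN nNg nNh /(rcoset_kercosetP nNg nNh)/rcosetP[n Nn ->] Nv.
rewrite conjgM; congr (_ ^ _)%g; apply/conjg_fixP/commgP.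
exact: (centsP abN).
Qed.

Section LiftMinnormal.
Local Open Scope group_scope.
Variables (p : nat) (Pi : profiniteGroupType).
Hypotheses (p_prime : prime p) (cd1 : cd_le p Pi 1).
Hypothesis dominating : strongly_dominating p Pi.
Variables (gT : finGroupType) (G N : {group gT}) (a : Pi -> coset_of N).
Hypotheses (minN : minnormal N G) (sNG : N \subset G) (pN : p.-group N).
Hypotheses (aM : {morph a : x y / x * y}) (a_lc : locally_constant a).
Hypothesis a_range : forall u, reflect (exists x, a x = u) (u \in G / N).

Lemma lift_minnormal : exists b : Pi -> gT,
  [/\ {morph b : x y / x * y}, locally_constant b,
      forall x, coset N (b x) = a x, forall x, b x \in G &
      forall g, g \in G -> exists x, b x = g].
Proof.
have [/andP[ntN nNG] _] := mingroupP minN.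
have abelN : p.-abelem N.
  have [_ _] := minnormal_solvable minN (fintype.subxx _) (pgroup_sol pN).
  by rewrite (is_abelem_pgroup pN).
have abN : abelian N by have [] := abelemP p_prime abelN.
have nsNG : N <| G by apply/andP.
have a1 : a 1 = 1 by apply: (mulgI (a 1)); rewrite -aM !mulg1.
have aV x : a x^-1 = (a x)^-1.
  by apply: (mulgI (a x)); rewrite -aM !mulgV a1.
(* Modules are additive, so [N] is replaced by a row space over the field with [p] elements, through
   [rho] and its inverse [nu]. *)
pose rho := abelem_rV abelN ntN; pose nu := rVabelem abelN ntN.
have rhoM : {in N &, {morph rho : u v / u * v >-> (u + v)%R}} by exact: abelem_rV_M.
have nuD : {morph nu : u v / (u + v)%R >-> u * v} by exact: rVabelemD.
have nuN : {morph nu : u / (- u)%R >-> u^-1} by exact: rVabelemN.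
have nuK : cancel nu rho by exact: rVabelemK.
have rhoK : {in N, cancel rho nu} by exact: abelem_rV_K.
have nuP v : nu v \in N by exact: mem_rVabelem.
pose s x : gT := fingroup.repr (a x).
have sE x : coset N (s x) = a x by exact: coset_reprK.
have s_norm x : s x \in 'N(N) by exact: repr_coset_norm.
have s_lc : locally_constant s.
  exact: (locally_constant_post (fun u : coset_of N => fingroup.repr u) a_lc).
have memG g x : g \in 'N(N) -> coset N g = a x -> g \in G.
  move=> nNg Eg; rewrite -(quotientGK nsNG) mem_morphpre //= Eg.
  by apply/a_range; exists x.
(* Conjugation [^] is a right action; the inverse turns it into a left one. *)
pose act x v := rho (nu v ^ (s x)^-1).
have nuJ x v : nu v ^ (s x)^-1 \in N by rewrite memJ_norm ?groupV.
have act1 v : act 1 v = v.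
  by rewrite /act /s a1 repr_coset1 invg1 conjg1 nuK.
have actM x y v : act (x * y) v = act x (act y v).
  rewrite /act rhoK // -conjgM -invMg; congr rho.
  apply: (conjg_eq_mod_abelian abN); rewrite ?groupV ?groupM //.
  by rewrite !morphV ?groupM ?morphM //= !sE aM.
have actD x u v : act x (u + v)%R = (act x u + act x v)%R.
  by rewrite /act nuD conjMg rhoM.
have act_lc v : locally_constant (act^~ v).
  exact: (locally_constant_post (fun g => rho (nu v ^ g^-1)) s_lc).
pose M := DiscreteGmodule act1 actM actD (orbit_map_continuous act_lc).
(* The factor set of the section [s]. *)
pose cN x y := s x * s y * (s (x * y))^-1.
have cNP x y : cN x y \in N.
  rewrite coset_idr ?groupM ?groupV //.
  by rewrite !morphM ?morphV ?groupM ?groupV //= !sE aM mulgV.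
pose c x y := rho (cN x y).
have sM x y : s x * s y = nu (c x y) * s (x * y) by rewrite /c rhoK // mulgVK.
have c_lc : locally_constant (fun u : Pi * Pi => c u.1 u.2).
  apply: (locally_constant_post (fun u => rho (u.1 * u.2.1 * u.2.2^-1))
    (f := fun u : Pi * Pi => (s u.1, (s u.2, s (u.1 * u.2))))).
  apply: locally_constant_pair; last apply: locally_constant_pair.
  - exact: (locally_constant_comp (@fst_continuous _ _) s_lc).
  - exact: (locally_constant_comp (@snd_continuous _ _) s_lc).
  - exact: (locally_constant_comp mulg_continuous s_lc).
have sJ x v : s x * nu v = nu (M x v) * s x.
  by rewrite rhoK // /conjg invgK -!mulgA mulVg mulg1.
have cP x y z : (c x y + c (x * y)%g z = M x (c y z) + c x (y * z)%g)%R.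
  (* The cocycle identity compares two bracketings of [s x * s y * s z]. *)
  apply: (can_inj nuK); apply: (mulIg (s (x * y * z))).
  transitivity (s x * s y * s z).
    by rewrite (sM x) -(mulgA (nu _)) (sM (x * y)) mulgA nuD.
  rewrite -(mulgA (s x)) (sM y z) (mulgA (s x)) sJ -(mulgA (nu _)) (sM x).
  by rewrite nuD (mulgA x) (mulgA (nu _)).
have nuMn v n : nu (v *+ n)%R = nu v ^+ n.
  elim: n => [|n IHn]; first by rewrite mulr0n /nu rVabelem0.
  by rewrite mulrS nuD IHn expgS.
have Vp v : (v *+ p = 0 :> 'rV['F_p]_(abelem_dim' N).+1)%R.
  apply: (can_inj nuK); rewrite nuMn /nu rVabelem0 -/nu.
  by have [_ ->] := abelemP p_prime abelN.
have [h0 h0_lc h0M] := cd_le1_split p_prime cd1 Vp c_lc cP.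
(* The maps h for which x |-> nu (h x) * s x is a homomorphism lifting a. *)
pose sol := [set h : Pi -> 'rV['F_p]_(abelem_dim' N).+1 | locally_constant h /\
  forall x y, (h (x * y)%g = h x + M x (h y) + c x y)%R]%classic.
(* Subtracting [h0] maps [sol] onto the crossed homomorphisms, which are infinite in number because
   H^1 is infinite. *)
have sol_inf : infinite_set sol.
  move=> sol_fin; have abelP := mx_Fp_abelem 1 (abelem_dim' N).+1 p_prime.
  apply: (@dominating _ M abelP).
    by rewrite card_abelem_rV // cardG_gt1.
  apply/(finite_cohomology1 M finite_finset).
  apply: sub_finite_set (finite_image (fun h x => h x - h0 x)%R sol_fin).
  move=> b [b_lc bM]; exists (fun x => h0 x + b x)%R.
    split=> [|x y]; last first.
      rewrite h0M bM gactD [LHS]addrAC; congr (_ + _)%R; exact: addrACA.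
    by move=> x; apply: filterS2 (h0_lc x) (b_lc x) => y /= -> ->.
  by apply/funext => x; rewrite addrAC subrr add0r.
pose beta (h : Pi -> 'rV['F_p]_(abelem_dim' N).+1) x := nu (h x) * s x.
have betaM h : sol h -> {morph beta h : x y / x * y}.
  move=> [_ hM] x y; rewrite /beta hM !nuD -(mulgA (_ * _)) -(sM x).
  by rewrite (mulgA (_ * _)) -(mulgA (nu (h x))) -(sJ x) !mulgA.
have beta_coset h x : coset N (beta h x) = a x.
  rewrite morphM //; last exact: (fintype.subsetP (normG N)).
  by rewrite /= coset_id ?mul1g.
have beta_norm h x : beta h x \in 'N(N).
  by rewrite groupM ?s_norm // (fintype.subsetP (normG N)).
have beta_lc h : sol h -> locally_constant (beta h).
  move=> [h_lc _] x; apply: filterS2 (h_lc x) (s_lc x) => y /= E1 E2.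
  by rewrite /beta E1 E2.
have [//|none] := pselect (exists2 h, sol h &
    forall g, g \in G -> exists x, beta h x = g).
  move=> [h h_sol h_surj]; exists (beta h); split=> //; [exact: betaM|exact: beta_lc|].
  by move=> x; apply: (memG _ x).
(* If no solution is onto, every [h] in [sol] factors through [a], and there are only finitely many
   functions on the finite type [coset_of N]. *)
exfalso; apply: sol_inf.
apply: sub_finite_set (finite_image
  (fun (u : {ffun coset_of N -> 'rV['F_p]_(abelem_dim' N).+1}) x => u (a x))
  (finite_finset (X := [set: _]%classic))).
move=> h h_sol; have hM := betaM h h_sol.
have b1 : beta h 1 = 1 by apply: (mulgI (beta h 1)); rewrite -hM !mulg1.
have bV x : beta h x^-1 = (beta h x)^-1.
  by apply: (mulgI (beta h x)); rewrite -hM !mulgV b1.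
pose H0 : {set gT} := finset (fun g => `[< exists x, beta h x = g >]).
have H0P g : reflect (exists x, beta h x = g) (g \in H0).
  by rewrite inE; exact: asboolP.
have H0_group : group_set H0.
  apply/group_setP; split; first by apply/H0P; exists 1.
  move=> _ _ /H0P[x <-] /H0P[y <-]; apply/H0P; exists (x * y); exact: hM.
pose H := Group H0_group.
have sHG : H \subset G.
  by apply/fintype.subsetP => _ /H0P[x <-]; apply: (memG _ x).
have sGNH : G \subset N * H.
  apply/fintype.subsetP => g Gg; have [x ax] := elimT (a_range _) (mem_quotient N Gg).
  rewrite -(mulgVK (beta h x) g); apply: mem_mulg; last by apply/H0P; exists x.
  have nNg := fintype.subsetP nNG g Gg.
  rewrite coset_idr ?groupM ?groupV //.
  by rewrite morphM ?morphV ?groupV //= beta_coset ax mulgV.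
have [HN1|sGH] := minnormal_cap minN abN sHG sGNH; last first.
  by case: none; exists h => // g /(fintype.subsetP sGH)/H0P.
(* The image [H] meets [N] trivially, so [beta h] depends only on [a x]; so does [s], and therefore
   [h]. *)
have h_eq x y : a x = a y -> h x = h y.
  move=> axy; have bxy : beta h x = beta h y.
    have : beta h (x * y^-1) \in H :&: N.
      rewrite inE; apply/andP; split; first by apply/H0P; exists (x * y^-1).
      by rewrite coset_idr ?beta_norm // beta_coset aM aV axy mulgV.
    by rewrite HN1 hM bV => /set1gP/eqP; rewrite -eq_mulgV1 => /eqP.
  by apply: (can_inj nuK); move: bxy; rewrite /beta /s axy => /mulIg.
(* The default 1 only serves cosets outside the range of [a]. *)
pose pick_x (u : coset_of N) := xget 1 [set x | a x = u]%classic.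
exists [ffun u => h (pick_x u)] => //; apply/funext => x; rewrite ffunE.
have ex_x : exists y, [set y | a y = a x]%classic y by exists x.
by apply: h_eq; exact: (xgetPex 1 ex_x).
Qed.

End LiftMinnormal.

(** By induction on the order of [G]: for [N] minimal normal in [G] inside the kernel, [f] factors
    through [G / N]. A surjective solution of that smaller problem is then lifted through [N]. *)
Lemma solve_finite_embedding (p : nat) (Pi : profiniteGroupType)
    (gT rT : finGroupType) (G : {group gT}) (f : {morphism G >-> rT})
    (a : Pi -> rT) :
  prime p -> cd_le p Pi 1 -> strongly_dominating p Pi ->
  {morph a : x y / (x * y)%g} -> locally_constant a ->
  (forall u, reflect (exists x, a x = u) (u \in f @* G)%g) ->
  (p.-group ('ker f))%g ->
  exists b : Pi -> gT,
  [/\ {morph b : x y / (x * y)%g}, locally_constant b,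
      forall x, f (b x) = a x, forall x, b x \in G &
      forall g, g \in G -> exists x, b x = g].
Proof.
move=> p_prime cd1 dominating.
have [n] := ubnP #|G|; elim: n => // n IHn in gT rT G f a *.
rewrite ltnS => leGn aM a_lc a_range pK.
have [kf1|ntK] := eqVneq ('ker f)%g 1%g.
  have injf : ('injm f)%g by rewrite kf1.
  have a_im x : a x \in (f @* G)%g by apply/a_range; exists x.
  exists (fun x => invm injf (a x)); split.
  - by move=> x y; rewrite aM morphM ?a_im.
  - exact: (locally_constant_post (fun u => invm injf u) a_lc).
  - by move=> x; rewrite invmK.
  - by move=> x; have /morphimP[g _ Gg ->] := a_im x; rewrite invmE.
  - move=> g Gg; have [x ax] := elimT (a_range (f g)) (mem_morphim f Gg Gg).
    by exists x; rewrite ax invmE.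
have [N minN sNK] := minnormal_exists ntK (ker_norm f).
have [/andP[ntN nNG] _] := mingroupP minN.
have sNG : N \subset G := fintype.subset_trans sNK (finset.subsetIl _ _).
have sKq : ('ker (coset N) \subset 'ker f)%g by rewrite ker_coset.
pose ff := factm_morphism sKq nNG.
have [|||u||b [bM b_lc fb b_in b_surj]] := IHn _ rT (G / N)%G ff a.
- exact: leq_trans (ltn_quotient ntN sNG) leGn.
- exact: aM.
- exact: a_lc.
- by rewrite morphim_factm.
- by rewrite ker_factm morphim_pgroup.
have b_range u : reflect (exists x, b x = u) (u \in (G / N)%g).
  by apply: (iffP idP) => [/b_surj //|[x <-]].
have [|c [cM c_lc cb c_in c_surj]] := lift_minnormal p_prime cd1 dominating
   minN sNG _ bM b_lc b_range.
  exact: pgroupS sNK pK.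
exists c; split=> // x.
by rewrite -fb -cb /= factmE.
Qed.

(** The carrier is kept and both maps are identities; naming them separates the new structure from
    the ones already on [H]. *)
Lemma finite_group_finGroupType (H : groupType) : finite_set [set: H] ->
  exists (gT : finGroupType) (i : H -> gT) (j : gT -> H),
    [/\ {morph i : x y / (x * y)%g}, cancel i j & cancel j i].
Proof.
move=> /finite_seqP[s sT].
have sP x : x \in s by have : [set` s] x by rewrite -sT.
have pK : pcancel (index^~ s) (fun n => onth s n).
  by move=> x; rewrite onthE (nth_map x) ?index_mem// nth_index.
have eP : Finite.axiom (undup s).
  by move=> x; rewrite count_uniq_mem ?undup_uniq// mem_undup sP.
pose cT := HB.pack_for countType H (Choice_isCountable.Build H pK).
pose fT := HB.pack_for finType H cT (isFinite.Build H eP).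
pose gT := HB.pack_for finGroupType H cT fT.
by exists gT, id, id.
Qed.

Theorem theorem4p2 (p : nat) (hp : prime p) (Pi : profiniteGroupType) :
  (forall E : embedding_problem Pi,
     finite_ep E -> p_ep p E -> has_proper_solution E)
  <-> (cd_le p Pi 1 /\ strongly_dominating p Pi).
Proof.
split=> [solvable|[cd1 dominating] E E_fin E_p].
  split; first exact: solvable_cd_le.
  exact: solvable_strongly_dominating.
have fG : finite_set [set: ep_G E].
  by rewrite -(ep_f_surjective E); exact: finite_image.
have [gT [i [j [iM iK jK]]]] := finite_group_finGroupType E_fin.
have [rT [k [l [kM kK lK]]]] := finite_group_finGroupType fG.
have jM : {morph j : x y / (x * y)%g}.
  by move=> x y; apply: (can_inj iK); rewrite iM !jK.
have k1 : k 1%g = 1%g by apply: (mulgI (k 1%g)); rewrite -kM !mulg1.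
have fM : {in [set: gT]%G &, {morph (fun g => k (ep_f E (j g))) : x y / (x * y)%g}}.
  by move=> x y _ _; rewrite jM gmulfM kM.
pose f := Morphism fM.
have [||u||b [bM b_lc fb _ b_surj]] :=
    @solve_finite_embedding p Pi gT rT [set: gT]%G f (k \o ep_alpha E) hp cd1 dominating.
- by move=> x y /=; rewrite gmulfM kM.
- apply: locally_constant_post; apply: continuous_locally_constant.
    (* Points of a finite Hausdorff space are open, since their complements are finite and so
       closed. *)
    move=> y; apply: open_nbhs_nbhs; split=> //.
    have /hausdorff_accessible/accessible_finite_set_closed acc :=
      @profinite_hausdorff (ep_G E).
    rewrite -[X in open X]setCK openC; apply: acc.
    exact: sub_finite_set fG.
  exact: ep_alpha_continuous.
- apply: (iffP idP) => [_|_].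
    have [x _ Ex] : range (ep_alpha E) (l u) by rewrite ep_alpha_surjective.
    by exists x; rewrite /= Ex lK.
  have [x _ Ex] : range (ep_f E) (l u) by rewrite ep_f_surjective.
  apply/morphimP; exists (i x); rewrite ?inE//=.
  by rewrite iK Ex lK.
(* By Cauchy, a prime [q] dividing the order of the kernel is the order of an element there; that
   order divides a power of [p], so [q = p]. *)
- apply/pgroupP => q q_prime /(Cauchy q_prime)[x x_ker xq].
  have [m xm] : exists m, (j x ^+ (p ^ m) = 1)%g.
    apply: E_p; apply: (can_inj kK); rewrite k1.
    by have /mker := x_ker.
  have jX n : j (x ^+ n)%g = (j x ^+ n)%g.
    elim: n => [|n IHn]; last by rewrite !expgS jM IHn.
    by apply: (mulgI (j 1%g)); rewrite -jM !mulg1.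
  have j1 : j 1%g = 1%g by rewrite -(expg0 x) jX.
  have : (#[x]%g %| p ^ m)%N.
    by rewrite order_dvdn; apply/eqP/(can_inj jK); rewrite jX xm j1.
  rewrite xq Euclid_dvdX// => /andP[+ _].
  by rewrite dvdn_prime2// inE.
have jbM : {morph (j \o b : Pi -> ep_Gamma E) : x y / (x * y)%g}.
  by move=> x y /=; rewrite bM jM.
exists (HB.pack_for {multiplicative Pi -> ep_Gamma E} (j \o b : Pi -> ep_Gamma E)
  (monoid.isMultiplicative.Build Pi (ep_Gamma E) (j \o b) jbM)).
split.
- apply: locally_constant_continuous; exact: (locally_constant_post j b_lc).
- apply/seteqP; split=> // g _; have [|x bx] := b_surj (i g); first by rewrite inE.
  by exists x => //=; rewrite bx iK.
- by move=> x; apply: (can_inj kK); exact: fb.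
Qed.
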